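(* Let $d,p\in\mathbb{N}$, $A\in\mathbb{C}^{d\times d}$, $(t_0,x_0)\in\mathbb{C}\times\mathbb{C}^d$, and consider the complex initial value problem $\dot{x}(t)=A\,x(t)$, $x(t_0)=x_0$. Let $\gamma$ be a curve, parametrized over $[0,1]$ with values in $\mathbb{C}$, with $\gamma(0)=t_0\in\mathbb{C}$ and $\gamma(1)=t\in\mathbb{C}$. For every $n\in\mathbb{N}$ define $\tau_j(n):=\gamma\left(\frac{j+1}{n}\right)-\gamma\left(\frac{j}{n}\right)$, $j\in\{0,\dots,n-1\}$, and $\delta_n:=\max_{0\le j\le n-1}|\tau_j(n)|$. Furthermore let $C\in\mathbb{R}^+$ be a constant such that $\delta_n\le C\frac{L(\gamma)}{n}$ for every $n\in\mathbb{N}$, where $L(\gamma):=\int_0^1|\dot\gamma(u)|\,du$ is the length of $\gamma$. If $\varepsilon_n$ denotes the grid error at the ending point $t$ corresponding to a $p$-stage explicit Runge-Kutta method of order $p$ applied to this initial value problem along the time grid $\Delta_n^\gamma$, then $$\lim_{n\to\infty}\frac{\varepsilon_n}{\delta_n^p}=\lim_{n\to\infty}\frac{1}{\delta_n^p}\sum_{j=0}^{n-1}\big(\tau_j(n)\big)^{p+1}\cdot\frac{A^{p+1}e^{(t-t_0)A}}{(p+1)!}\,x_0.$$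
   Context: For a curve $\gamma$ parametrized over $[0,1]$ with values in $\mathbb{C}$ and $n\in\mathbb{N}$, the associated time grid is the indexed set $\Delta_n^\gamma=[t_0,\dots,t_n]$ with $t_j=\gamma(j/n)$ (so the last grid point $t_n$ is the ending point $t=\gamma(1)$); its time steps $\tau_j(n)=t_{j+1}-t_j$ are complex numbers, and $\delta_n$ is its maximum step size. An $s$-stage explicit Runge-Kutta method with coefficients $\mathfrak{A}\in\mathbb{C}^{s\times s}$ (strictly lower triangular) and $\mathfrak{b},\mathfrak{c}\in\mathbb{C}^s$, applied to $\dot{x}=Ax$, has the one-step map (discrete evolution) $\Psi^{t+\tau,t}x=x+\tau\sum_{i=1}^s\mathfrak{b}_ik_i$ with stages $k_i=Ax+\tau\sum_{j=1}^{i-1}\mathfrak{A}_{i,j}Ak_j$, where $\tau\in\mathbb{C}$. ''Order $p$'' is meant in the usual sense for Runge-Kutta methods. The grid function $x_\Delta$ on a time grid $\Delta=[t_0,\dots,t_n]$ is defined recursively by $x_\Delta(t_0)=x_0$ and $x_\Delta(t_{j+1})=\Psi^{t_{j+1},t_j}x_\Delta(t_j)$ for $j\in\{0,\dots,n-1\}$. The grid error is the exact solution value minus the grid function value; at the ending point $t$ it is $\varepsilon_n=e^{(t-t_0)A}x_0-x_{\Delta_n^\gamma}(t)\in\mathbb{C}^d$, where $x_{\Delta_n^\gamma}(t)$ is the value obtained at the last grid index $j=n$. *)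

(* Defs.v *)
From HB Require Import structures.
From mathcomp Require Import all_boot all_order all_algebra.
From mathcomp Require Import all_classical all_reals all_analysis.
From mathcomp Require Import complex.

Set Implicit Arguments.
Unset Strict Implicit.
Unset Printing Implicit Defensive.

Import Order.TTheory GRing.Theory Num.Theory numFieldNormedType.Exports.

Local Open Scope classical_set_scope.
Local Open Scope ring_scope.

(* The norm and topology that the library gives to every abstract numFieldType;
   its instances are not found on the concrete type R[i]. *)
HB.instance Definition _ (R : rcfType) := NormedModule.copy R[i] (R[i])^o.

Definition expmx (K : numFieldType) (d : nat) (A : 'M[K]_d) : 'M[K]_d :=
  limn (series (fun k : nat => (k`!%:R)^-1 *: A ^+ k)).

Section RungeKutta.
Variable K : numFieldType.

Record explicit_rk (s : nat) := ExplicitRK {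
  rkA : 'M[K]_s;
  rkb : 'cV[K]_s;
  rkc : 'cV[K]_s;
  rkA_strictly_lower : forall i j : 'I_s, (i <= j)%N -> rkA i j = 0 }.

Section OneStep.
Variables (s : nat) (M : explicit_rk s) (m : nat).
Variables (f : K -> 'cV[K]_m -> 'cV[K]_m) (t tau : K) (x : 'cV[K]_m).

(* [n] is only fuel: every [n > i] gives the same value, see [rk_stageE]. *)
Fixpoint rk_stage_rec (n : nat) (i : 'I_s) : 'cV[K]_m :=
  if n is n'.+1 then
    f (t + rkc M i 0 * tau)
      (x + tau *: \sum_(j < s | (j < i)%N) rkA M i j *: rk_stage_rec n' j)
  else 0.

Definition rk_stage (i : 'I_s) : 'cV[K]_m := rk_stage_rec i.+1 i.

Lemma rk_stage_recE (n n' : nat) (i : 'I_s) :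
  (i < n)%N -> (i < n')%N -> rk_stage_rec n i = rk_stage_rec n' i.
Proof.
elim: n n' i => [//|n IHn] [//|n'] i; rewrite !ltnS => ni n'i /=.
congr (f _ (_ + _ *: _)); apply: eq_bigr => j ji; congr (_ *: _).
by apply: IHn; apply: leq_trans ji _.
Qed.

Lemma rk_stageE (i : 'I_s) :
  rk_stage i = f (t + rkc M i 0 * tau)
    (x + tau *: \sum_(j < s | (j < i)%N) rkA M i j *: rk_stage j).
Proof.
rewrite {1}/rk_stage /=; congr (f _ (_ + _ *: _)).
by apply: eq_bigr => j ji; congr (_ *: _); apply: rk_stage_recE.
Qed.

Definition rk_step : 'cV[K]_m := x + tau *: \sum_(i < s) rkb M i 0 *: rk_stage i.

End OneStep.

(* Local error O(tau^(p+1)) for all sufficiently smooth, possibly nonautonomous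
   right-hand sides [f].  For K = R[i] differentiability near a
   point is holomorphy, so [f] and the exact solution [x] are analytic there. *)
Definition rk_order (s : nat) (M : explicit_rk s) (p : nat) : Prop :=
  forall (m : nat) (f : K -> 'cV[K]_m -> 'cV[K]_m) (x : K -> 'cV[K]_m) (t0 : K),
    (\forall z \near ((t0, x t0) : K * 'cV[K]_m),
       differentiable (fun w : K * 'cV[K]_m => f w.1 w.2) z) ->
    (\forall t \near t0, is_derive (t : K) (1 : K) x (f t (x t))) ->
    exists B : K, \forall tau \near (0 : K),
      `|x (t0 + tau) - rk_step M f t0 tau (x t0)| <= B * `|tau| ^+ p.+1.

(* The grid function is indexed by [j] and not by the grid point [g j], since
   grid points may coincide. *)
Fixpoint grid_fun (s : nat) (M : explicit_rk s) (m : nat)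
    (f : K -> 'cV[K]_m -> 'cV[K]_m) (g : nat -> K) (x0 : 'cV[K]_m) (j : nat) :
    'cV[K]_m :=
  if j is j'.+1 then
    rk_step M f (g j') (g j'.+1 - g j') (grid_fun M f g x0 j')
  else x0.

End RungeKutta.

Section Curve.
Variable R : realType.
Implicit Type gamma : R -> R[i].

Local Notation cabs := (@ComplexField.Normc.normc R).

Definition curve_deriv gamma (u : R) : R[i] :=
  Complex (derive1 (fun v => complex.Re (gamma v)) u)
          (derive1 (fun v => complex.Im (gamma v)) u).

(* The weakest regularity for which the length integral below makes sense; it
   includes the piecewise continuously differentiable curves. *)
Definition is_curve gamma : Prop :=
  [/\ {within `[0, 1], continuous gamma},
      {ae lebesgue_measure, forall u : R, u \in `[0, 1] ->
        derivable (fun v => complex.Re (gamma v)) u 1 /\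
        derivable (fun v => complex.Im (gamma v)) u 1} &
      lebesgue_measure.-integrable `[0, 1]
        (fun u => (cabs (curve_deriv gamma u))%:E)].

Definition curve_length gamma : R :=
  \int[lebesgue_measure]_(u in `[0, 1]) cabs (curve_deriv gamma u).

Definition curve_grid gamma (n j : nat) : R[i] := gamma (j%:R / n%:R).

Definition grid_step gamma (n j : nat) : R[i] :=
  curve_grid gamma n j.+1 - curve_grid gamma n j.

Definition max_step gamma (n : nat) : R :=
  \big[Num.max/0]_(j < n) cabs (grid_step gamma n j).

Definition end_error (d s : nat) (A : 'M[R[i]]_d) (M : explicit_rk R[i] s)
    gamma (x0 : 'cV[R[i]]_d) (n : nat) : 'cV[R[i]]_d :=
  expmx ((gamma 1 - gamma 0) *: A) *m x0 -
  grid_fun M (fun (_ : R[i]) (x : 'cV[R[i]]_d) => A *m x)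
    (curve_grid gamma n) x0 n.

End Curve.

(* Main.v *)
Require Import Defs.
From HB Require Import structures.
From mathcomp Require Import all_boot all_order all_algebra.
From mathcomp Require Import all_classical all_reals all_analysis.
From mathcomp Require Import complex.
From mathcomp Require Import measurable_realfun ring lra.

Set Implicit Arguments.
Unset Strict Implicit.
Unset Printing Implicit Defensive.

Import Order.TTheory GRing.Theory Num.Theory numFieldNormedType.Exports.

Local Open Scope classical_set_scope.
Local Open Scope ring_scope.
Local Open Scope complex_scope.

(** The theorem has two independent halves: an expansion of the error, and the
    existence of a limit of the normalised power sum of the steps.

    Expansion.  Applied to [x' = A x], one step of an explicit method with [p]
    stages is [x |-> P(tau A) x] for a polynomial [P] of degree at most [p]
    ([rk_step_linear], [size_stability_poly]).  Order [p] forces [P] to be the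
    Taylor polynomial of the exponential ([order_stability_poly]): it suffices
    to test the method on a nilpotent linear system of dimension [p + 1], whose
    solutions are polynomials.  Hence
      [exp(- tau A) P(tau A) = 1 - u],
      [u = tau^(p+1) A^(p+1) / (p+1)! + O(tau^(p+2))]  ([step_defect]).
    All these matrices commute, so the numerical solution at the end point is
    the exact flow applied to the product of the [1 - u_j]
    ([grid_fun_expmx]).  As [n delta_n] is bounded, that product is
    [1 - \sum_j u_j + O(delta_n^(2p))], and the error is
      [(\sum_j tau_j^(p+1)) A^(p+1) exp((t - t0) A) x0 / (p+1)!
         + O(delta_n^(p+1))]  ([grid_error_expansion]).
    After division by [delta_n^p] the two sequences of the theorem differ by
    [O(delta_n)].

    Limit.  It remains to see that [delta_n^(-p) \sum_j tau_j^(p+1)]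
    converges.  It equals [(n delta_n)^(-p)] times the average of the
    [(n tau_j)^(p+1)].  The numbers [n delta_n] converge to their supremum
    ([cvg_scaled_step]), by comparison of two grids through their common
    refinement.  The averages are integrals of uniformly bounded step functions
    which converge almost everywhere to the [(p+1)]-st power of the derivative
    of the curve, so they converge by dominated convergence
    ([cvg_power_sum]).  If the supremum is [0] the curve does not move along any
    grid and both sequences vanish. *)

(** * The stability polynomial of an explicit Runge-Kutta method *)

Section StabilityPolynomial.
Variables (K : numFieldType) (s : nat) (M : explicit_rk K s).

(** As in [rk_stage_rec], [n] is fuel: the polynomial [q] of stage [i] is such
    that the stage equals [A *m q(tau A) *m x] when the right-hand side is
    [x |-> A *m x]. *)
Fixpoint stage_poly (n : nat) (i : 'I_s) : {poly K} :=
  if n is n'.+1 then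
    1 + 'X * \sum_(j < s | (j < i)%N) rkA M i j *: stage_poly n' j
  else 0.

Definition stability_poly : {poly K} :=
  1 + 'X * \sum_(i < s) rkb M i 0 *: stage_poly i.+1 i.

Lemma size_1_addXM (n : nat) (q : {poly K}) :
  (size q <= n)%N -> (size (1 + 'X * q)%R <= n.+1)%N.
Proof.
move=> qn; apply: leq_trans (size_polyD _ _) _.
rewrite size_polyC oner_neq0 geq_max /=.
have [->|q0] := eqVneq q 0; first by rewrite mulr0 size_poly0.
by rewrite mulrC size_mulX.
Qed.

(** Each level of the recursion multiplies by [A] once.  Since the method is
    explicit, [i.+1] levels suffice for stage [i], so that [s] stages yield a
    stability polynomial of degree at most [s]. *)
Lemma size_stage_poly n i : (size (stage_poly n i) <= n)%N.
Proof.
elim: n i => [|n IHn] i /=; first by rewrite size_poly0.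
apply: size_1_addXM; apply: (leq_trans (size_sum _ _ _)).
by apply/bigmax_leqP => j _; apply: leq_trans (size_scale_leq _ _) (IHn j).
Qed.

Lemma size_stability_poly : (size stability_poly <= s.+1)%N.
Proof.
apply: size_1_addXM; apply: (leq_trans (size_sum _ _ _)).
apply/bigmax_leqP => i _; apply: leq_trans (size_scale_leq _ _) _.
exact: leq_trans (size_stage_poly _ _) (ltn_ord i).
Qed.

Variables (m : nat) (A : 'M[K]_m.+1).
Local Notation linear_rhs := (fun (_ : K) (x : 'cV[K]_m.+1) => A *m x).

Lemma horner_mx_1_addXM (tau : K) (I : Type) (r : seq I) (P : pred I)
    (c : I -> K) (q : I -> {poly K}) (x : 'cV[K]_m.+1) :
  x + tau *: \sum_(j <- r | P j) c j *:
     (A *m (horner_mx (tau *: A) (q j) *m x)) =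
  horner_mx (tau *: A) (1 + 'X * \sum_(j <- r | P j) c j *: q j) *m x.
Proof.
rewrite rmorphD rmorph1 rmorphM /= horner_mx_X rmorph_sum mulmxDl mul1mx.
congr (_ + _); rewrite -mulmxE -!scalemxAl -mulmxA; congr (_ *: _).
rewrite mulmx_suml mulmx_sumr; apply: eq_bigr => j _.
by rewrite [X in _ = A *m (X *m x)]horner_mxZ -scalemxAl -scalemxAr.
Qed.

Lemma rk_stage_rec_linear (t tau : K) (x : 'cV[K]_m.+1) n i :
  rk_stage_rec M linear_rhs t tau x n i =
  A *m (horner_mx (tau *: A) (stage_poly n i) *m x).
Proof.
elim: n i => [|n IHn] i /=; first by rewrite rmorph0 mul0mx mulmx0.
by rewrite -horner_mx_1_addXM; under eq_bigr do rewrite IHn.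
Qed.

(** On a linear equation the step is multiplication by a polynomial in
    [tau *: A] whose coefficients depend on the method alone; so they can be
    identified on one well-chosen equation. *)
Lemma rk_step_linear (t tau : K) (x : 'cV[K]_m.+1) :
  rk_step M linear_rhs t tau x = horner_mx (tau *: A) stability_poly *m x.
Proof.
rewrite /rk_step -horner_mx_1_addXM.
by under eq_bigr do rewrite /rk_stage rk_stage_rec_linear.
Qed.

End StabilityPolynomial.

(** * The order conditions seen by a nilpotent linear equation *)

Section OrderDeterminesPolynomial.
Variable K : numFieldType.

Lemma is_derive_scale_cst (V : normedModType K) (f : K -> K) (t df : K) (v : V) :
  is_derive t 1 f df -> is_derive t 1 (fun u => f u *: v) (df *: v).
Proof.
move=> [fd fE].
have H : (fun h => h^-1 *: (((fun u => f u *: v) \o shift t) (h *: (1 : K)) -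
    f t *: v)) @ 0^' --> df *: v.
  under eq_fun do rewrite /= -scalerBl scalerA.
  by apply: cvgZr_tmp; rewrite -fE; exact: fd.
split; first by apply/cvg_ex; eexists; exact: H.
exact: (cvg_lim (@norm_hausdorff _ _) H).
Qed.

Lemma mulmx_col_continuous (m n : nat) (A : 'M[K]_(m, n)) :
  continuous (fun x : 'cV[K]_n => A *m x).
Proof.
have -> : (fun x : 'cV[K]_n => A *m x) =
   (fun x => \sum_(j < n) x j 0 *: col j A).
  apply/funext => x; apply/colP => i; rewrite mxE summxE.
  by apply: eq_bigr => j _; rewrite !mxE mulrC.
move=> x.
apply: (@cvg_big 'cV[K]_m _ +%R 0 xpredT (@add_continuous _) _ (nbhs x) _
  (fun j (y : 'cV[K]_n) => y j 0 *: col j A) (fun j => x j 0 *: col j A)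
  (nbhs_filter x)) => j _.
by apply: cvgZr_tmp; exact: coord_continuous.
Qed.

Lemma differentiable_linear_rhs (m : nat) (A : 'M[K]_m) (z : K * 'cV[K]_m) :
  differentiable (fun w : K * 'cV[K]_m => A *m w.2) z.
Proof.
have cA : continuous (fun w : K * 'cV[K]_m => A *m w.2).
  move=> w; apply: (@continuous_comp _ _ _ snd (mulmx A)); first exact: cvg_snd.
  exact: mulmx_col_continuous.
exact: (@linear_differentiable _ _ _ (mulmx A \o snd)).
Qed.

Lemma le_normr_cV (m : nat) (x : 'cV[K]_m) (i : 'I_m) : `|x i 0| <= `|x|.
Proof.
rewrite [leRHS]/Num.Def.normr /= mx_normE -[leLHS]nngE num_le.
exact: (le_bigmax _ (fun k : 'I_m * 'I_1 => `|x k.1 k.2|%:nng) (i, 0)).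
Qed.

(** Dividing by [tau ^+ i] leaves [`|e| <= B * `|tau|] for arbitrarily small
    nonzero [tau]. *)
Lemma bigO_monomial_eq0 (e B : K) (i p : nat) : (i <= p)%N ->
  (\forall tau \near (0 : K), `|tau ^+ i * e| <= B * `|tau| ^+ p.+1) -> e = 0.
Proof.
move=> ip H; apply/eqP; apply: contraT => e0.
have eB : 0 < `|e| / (`|B| + 1) by rewrite divr_gt0 ?normr_gt0 ?ltr_wpDl.
have : \forall tau \near (0 : K)^', [/\ `|tau ^+ i * e| <= B * `|tau| ^+ p.+1,
    `|tau| < 1, `|tau| < `|e| / (`|B| + 1) & tau != 0].
  near=> tau; split; near: tau.
  - exact: nbhs_dnbhs.
  - exact: dnbhs0_lt.
  - exact: dnbhs0_lt.
  - exact: nbhs_dnbhs_neq.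
move=> /filter_ex[tau [le_e lt1 lteB tau0]].
have ti : 0 < `|tau| ^+ i by rewrite exprn_gt0 ?normr_gt0.
have : `|tau| ^+ i * `|e| <= `|tau| ^+ i * (`|B| * `|tau|).
  rewrite -normrX -normrM (le_trans le_e)//.
  rewrite (le_trans (real_ler_norm _))//.
    by rewrite (ger0_real (le_trans _ le_e)).
  rewrite normrM !normrX normr_id mulrCA ler_wpM2l//.
  by rewrite -exprSr ler_wiXn2l// ltW.
rewrite ler_pM2l// => le_eB.
move: lteB; rewrite ltr_pdivlMr ?ltr_wpDl// mulrDr mulr1 mulrC.
move=> lteB; suff : `|e| < `|e| by rewrite ltxx.
by apply: le_lt_trans lteB; rewrite (le_trans le_eB)// lerDl.
Unshelve. all: by end_near. Qed.


(** The test equation is [x' = N *m x] with [N] the nilpotent shift.  Its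
    solution is polynomial in time, so no exponential function on the abstract
    field [K] is required, and the powers [N ^+ k *m delta_mx 0 0] for
    [k <= p] are distinct basis vectors, so that the components of one step are
    the coefficients of the stability polynomial. *)
Definition shift_mx (n : nat) : 'M[K]_n := \matrix_(i, j) (i == j.+1 :> nat)%:R.

Lemma shift_mxXe0 (p k : nat) : (k <= p)%N ->
  shift_mx p.+1 ^+ k *m delta_mx 0 0 = \col_i (i == k :> nat)%:R :> 'cV[K]__.
Proof.
elim: k => [|k IHk] kp.
  by rewrite expr0 mul1mx; apply/colP => i; rewrite !mxE eqxx andbT.
have -> : shift_mx p.+1 ^+ k.+1 = shift_mx p.+1 *m shift_mx p.+1 ^+ k.
  exact: exprS.
rewrite -mulmxA (IHk (ltnW kp)); apply/colP => i; rewrite !mxE.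
rewrite (bigD1 (inord k)) //= big1 ?addr0 => [|j jk]; rewrite !mxE.
  by rewrite inordK ?(leqW kp)// eqxx mulr1.
rewrite (_ : (j == k :> nat) = false) ?mulr0//.
by apply: contra_neqF jk => /eqP <-; rewrite inord_val.
Qed.

Lemma poly_size_leE (n : nat) (q : {poly K}) :
  (size q <= n)%N -> q = \poly_(k < n) q`_k.
Proof.
move=> sq; apply/polyP => k; rewrite coef_poly; case: ltnP => // nk.
by rewrite nth_default// (leq_trans sq).
Qed.

Lemma horner_shift_mx (p : nat) (q : {poly K}) (tau : K) (i : 'I_p.+1) :
  (size q <= p.+1)%N ->
  (horner_mx (tau *: shift_mx p.+1) q *m delta_mx 0 0 : 'cV[K]__) i 0 =
  tau ^+ i * q`_i.
Proof.
move=> sq; rewrite {1}(poly_size_leE sq) poly_def.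
have -> : forall r : 'I_p.+1 -> {poly K}, horner_mx (tau *: shift_mx p.+1)
    (\sum_(k < p.+1) r k) =
    \sum_(k < p.+1) horner_mx (tau *: shift_mx p.+1) (r k).
  by move=> r; rewrite rmorph_sum.
rewrite mulmx_suml summxE.
rewrite (bigD1 i) //= big1 ?addr0 => [|j ji];
  rewrite horner_mxZ rmorphXn /= horner_mx_X exprZn scalerA -scalemxAl
    shift_mxXe0 ?leq_ord// !mxE.
  by rewrite eqxx mulr1 mulrC.
rewrite (_ : (i == j :> nat) = false) ?mulr0//.
by rewrite eq_sym; exact: negbTE ji.
Qed.

Definition exp_jet (p : nat) (t : K) : 'cV[K]_p.+1 :=
  \sum_(k < p.+1) (k`!%:R^-1 * t ^+ k) *: delta_mx k 0.

Lemma exp_jetE p t i : exp_jet p t i 0 = i`!%:R^-1 * t ^+ i.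
Proof.
rewrite summxE (bigD1 i) //= big1 ?addr0 => [|j ji]; rewrite !mxE.
  by rewrite !eqxx mulr1.
by rewrite eq_sym (negbTE ji) mulr0.
Qed.

Lemma is_derive_exp_jet p (t : K) :
  is_derive t 1 (exp_jet p) (shift_mx p.+1 *m exp_jet p t).
Proof.
have -> : shift_mx p.+1 *m exp_jet p t =
   \sum_(k < p.+1) (k`!%:R^-1 * (t ^+ k.-1 *+ k)) *: delta_mx k 0.
  apply/colP => i.
  rewrite mxE summxE [RHS](bigD1 i) //= [X in _ = _ + X]big1 ?addr0.
    rewrite [RHS]mxE [delta_mx _ _ _ _]mxE !eqxx mulr1.
    case: i => [[|i] ip] /=.
      by rewrite mulr0n mulr0 big1// => j _; rewrite mxE mul0r.
    rewrite (bigD1 (Ordinal (ltnW ip))) //= big1 ?addr0 => [|j ji].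
      rewrite !mxE eqxx mul1r exp_jetE /= factS natrM invfM.
      rewrite -[t ^+ i *+ _]mulr_natl mulrACA mulVf ?mul1r//.
    rewrite mxE eqSS (_ : (i == j :> nat) = false) ?mul0r//.
    by apply: contra_neqF ji => /eqP ij; apply: val_inj.
  by move=> j ji; rewrite !mxE eq_sym (negbTE ji) mulr0.
have -> : exp_jet p = \sum_(k < p.+1)
    (fun u : K => (k`!%:R^-1 * u ^+ k) *: delta_mx k 0 : 'cV[K]_p.+1).
  by apply/funext => u; rewrite fct_sumE.
apply: is_derive_sum => k; apply: is_derive_scale_cst.
have := is_deriveZ (k`!%:R^-1 : K) (is_deriveX k (is_derive_id t (1 : K))).
rewrite (_ : _ \*: _ = fun u => k`!%:R^-1 * u ^+ k); last first.
  by apply/funext => u; rewrite /= fctE.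
rewrite (_ : _ *: _ = k`!%:R^-1 * (t ^+ k.-1 *+ k))//.
by rewrite /GRing.scale /= mulr1 mulr_natl.
Qed.

(** Component [k] of the error of one step of size [tau] on the test equation is
    [tau ^+ k * (k`!%:R^-1 - P`_k)].  Being [O(tau ^+ p.+1)] with [k <= p], it
    is zero; and a method with [p] stages has no coefficient beyond [p]. *)
Lemma order_stability_poly (p : nat) (M : explicit_rk K p) :
  rk_order M p -> stability_poly M = \poly_(k < p.+1) k`!%:R^-1.
Proof.
move=> hM; have [] := hM p.+1 (fun _ x => shift_mx p.+1 *m x) (exp_jet p) 0.
- apply: (nearW (nbhs_filter (0 : K, exp_jet p 0))) => z.
  exact: differentiable_linear_rhs.
- by apply: (nearW (nbhs_filter (0 : K))) => t; exact: is_derive_exp_jet.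
move=> B HB; rewrite (poly_size_leE (size_stability_poly M)).
apply/polyP => k; rewrite !coef_poly; case: ltnP => // kp.
apply/esym/eqP; rewrite -subr_eq0; apply/eqP.
apply: (@bigO_monomial_eq0 _ B k p kp).
apply: filterS HB => tau; apply: le_trans.
apply: le_trans (le_normr_cV _ (Ordinal kp)).
rewrite rk_step_linear [X in _ <= `|X|]mxE [X in _ <= `|_ + X|]mxE.
rewrite add0r exp_jetE.
rewrite (_ : exp_jet p 0 = delta_mx 0 0) ?horner_shift_mx ?size_stability_poly//.
  by rewrite mulrBr [X in _ <= `|X - _|]mulrC.
apply/colP => i; rewrite exp_jetE !mxE eqxx andbT expr0n.
by case: i => [[|i] ip] /=; rewrite ?mulr0// fact0 invr1 mulr1.
Qed.

End OrderDeterminesPolynomial.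
(** * A submultiplicative real norm on complex matrices *)

Section MatrixNorm.
Variable R : realType.
Local Notation cabs := (@ComplexField.Normc.normc R).

Lemma cabsD (x y : R[i]) : cabs (x + y) <= cabs x + cabs y.
Proof. exact: (le_normcD (x : Rcomplex R) y). Qed.

Lemma cabsN (x : R[i]) : cabs (- x) = cabs x.
Proof. exact: (normcN (x : Rcomplex R)). Qed.

Lemma cabs_ge0 (x : R[i]) : 0 <= cabs x.
Proof. by case: x => a b; rewrite sqrtr_ge0. Qed.

Lemma cabs0 : cabs 0 = 0.
Proof. exact: ComplexField.Normc.normc0. Qed.

Lemma cabs1 : cabs 1 = 1.
Proof. exact: ComplexField.Normc.normc1. Qed.

Lemma cabsM (x y : R[i]) : cabs (x * y) = cabs x * cabs y.
Proof. exact: ComplexField.Normc.normcM. Qed.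

Lemma cabsX (x : R[i]) n : cabs (x ^+ n) = cabs x ^+ n.
Proof.
by elim: n => [|n IHn]; rewrite ?expr0 ?cabs1// !exprS cabsM IHn.
Qed.

Lemma cabsV (x : R[i]) : cabs x^-1 = (cabs x)^-1.
Proof. exact: ComplexField.Normc.normcV. Qed.

Lemma cabs_real (a : R) : cabs a%:C = `|a|.
Proof. by rewrite /= expr0n addr0 sqrtr_sqr. Qed.

Lemma cabs_nat n : cabs n%:R = n%:R.
Proof.
by rewrite -[n%:R](rmorph_nat (real_complex R)) cabs_real normr_nat.
Qed.

Lemma cabs_sum (I : Type) (r : seq I) (P : pred I) (F : I -> R[i]) :
  cabs (\sum_(i <- r | P i) F i) <= \sum_(i <- r | P i) cabs (F i).
Proof.
elim/big_ind2 : _ => //; first by rewrite cabs0.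
by move=> x a y b xa yb; rewrite (le_trans (cabsD _ _))// lerD.
Qed.

Lemma normr_Re_le (x : R[i]) : `|complex.Re x| <= cabs x.
Proof.
case: x => a b /=; rewrite -sqrtr_sqr ler_wsqrtr// lerDl; exact: sqr_ge0.
Qed.

Lemma normr_Im_le (x : R[i]) : `|complex.Im x| <= cabs x.
Proof.
case: x => a b /=; rewrite -sqrtr_sqr ler_wsqrtr// lerDr; exact: sqr_ge0.
Qed.

Lemma cabs_le_ReIm (x : R[i]) :
  cabs x <= `|complex.Re x| + `|complex.Im x|.
Proof.
case: x => a b /=; rewrite -[leRHS]ger0_norm ?addr_ge0// -sqrtr_sqr.
rewrite ler_wsqrtr// sqrrD !real_normK ?num_real// addrAC lerDl.
by rewrite mulrn_wge0// mulr_ge0.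
Qed.

(** The sum of the moduli of the entries, as a real number.  Unlike the
    entrywise maximum it is submultiplicative without a dimension factor, also
    for rectangular products; and it avoids inequalities in the partially
    ordered [R[i]].  Note that [mxn 1] is the dimension and not [1]. *)
Definition mxn (m n : nat) (A : 'M[R[i]]_(m, n)) : R :=
  \sum_i \sum_j cabs (A i j).

Section Rectangular.
Variables m n : nat.
Implicit Types A B : 'M[R[i]]_(m, n).

Lemma mxn_ge0 A : 0 <= mxn A.
Proof. by apply: sumr_ge0 => i _; apply: sumr_ge0 => j _; exact: cabs_ge0. Qed.

Lemma mxn0 : mxn (0 : 'M[R[i]]_(m, n)) = 0.
Proof.
by rewrite /mxn big1// => i _; rewrite big1// => j _; rewrite mxE cabs0.
Qed.

Lemma mxnD A B : mxn (A + B) <= mxn A + mxn B.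
Proof.
rewrite /mxn -big_split; apply: ler_sum => i _.
by rewrite -big_split; apply: ler_sum => j _; rewrite mxE cabsD.
Qed.

Lemma mxnN A : mxn (- A) = mxn A.
Proof.
by apply: eq_bigr => i _; apply: eq_bigr => j _; rewrite mxE cabsN.
Qed.

Lemma mxnB A B : mxn (A - B) <= mxn A + mxn B.
Proof. by rewrite -(mxnN B) mxnD. Qed.

Lemma mxnBC A B : mxn (A - B) = mxn (B - A).
Proof. by rewrite -mxnN opprB. Qed.

Lemma mxnZ (z : R[i]) A : mxn (z *: A) = cabs z * mxn A.
Proof.
rewrite /mxn mulr_sumr; apply: eq_bigr => i _.
by rewrite mulr_sumr; apply: eq_bigr => j _; rewrite mxE cabsM.
Qed.

Lemma mxn_sum (I : Type) (r : seq I) (P : pred I) (F : I -> 'M[R[i]]_(m, n)) :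
  mxn (\sum_(i <- r | P i) F i) <= \sum_(i <- r | P i) mxn (F i).
Proof.
elim/big_ind2 : _ => //; first by rewrite mxn0.
by move=> x a y b xa yb; rewrite (le_trans (mxnD _ _))// lerD.
Qed.

Lemma cabs_le_mxn A i j : cabs (A i j) <= mxn A.
Proof.
rewrite /mxn (bigD1 i) //= (bigD1 j) //= -addrA lerDl addr_ge0//.
  by apply: sumr_ge0 => k _; exact: cabs_ge0.
by apply: sumr_ge0 => k _; apply: sumr_ge0 => l _; exact: cabs_ge0.
Qed.

Lemma mxn_eq0 A : mxn A = 0 -> A = 0.
Proof.
move=> A0; apply/matrixP => i j; rewrite mxE.
apply: ComplexField.Normc.eq0_normc; apply/eqP.
by rewrite eq_le cabs_ge0 andbT -A0 cabs_le_mxn.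
Qed.

Lemma normr_le_mxn A : `|A| <= (mxn A)%:C.
Proof.
rewrite [leLHS]/Num.Def.normr /= mx_normE.
have A0 : 0 <= (mxn A)%:C by rewrite lecR mxn_ge0.
rewrite -[leRHS]/(NngNum A0)%:num num_le; apply/bigmax_leP; split => //= ij _.
rewrite -num_le /= normc_def lecR.
rewrite (_ : Num.sqrt _ = cabs (A ij.1 ij.2)) ?cabs_le_mxn//.
by case: (A _ _).
Qed.

(** The link with the topology of matrices over [R[i]], whose norm is the
    maximum of the moduli. *)
Lemma cvg_mxn (u : nat -> 'M[R[i]]_(m, n)) (l : 'M[R[i]]_(m, n)) :
  mxn (u k - l) @[k --> \oo] --> (0 : R) -> u @ \oo --> l.
Proof.
move=> ul; apply/cvgrPdist_lt => e e0.
have [eRe e1] : e = (complex.Re e)%:C /\ 0 < complex.Re e.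
  by move: e0; case: e => a b; rewrite ltcE /= => /andP[/eqP -> ->].
move/cvgrPdist_lt : ul => /(_ _ e1); apply: filterS => k.
rewrite sub0r normrN ger0_norm ?mxn_ge0// mxnBC => ulk.
by rewrite (le_lt_trans (normr_le_mxn _))// eRe ltcR.
Qed.

End Rectangular.

Lemma mxnM (m n p : nat) (A : 'M[R[i]]_(m, n)) (B : 'M[R[i]]_(n, p)) :
  mxn (A *m B) <= mxn A * mxn B.
Proof.
rewrite /mxn mulr_suml; apply: ler_sum => i _.
apply: (@le_trans _ _ (\sum_j \sum_k cabs (A i k) * cabs (B k j))).
  apply: ler_sum => j _; rewrite mxE (le_trans (cabs_sum _ _ _))//.
  by apply: ler_sum => k _; rewrite cabsM.
rewrite exchange_big mulr_suml; apply: ler_sum => k _ /=.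
rewrite -mulr_sumr ler_wpM2l ?cabs_ge0// [leRHS](bigD1 k) //= lerDl.
by apply: sumr_ge0 => l _; apply: sumr_ge0 => j _; exact: cabs_ge0.
Qed.

Lemma mxnX (n : nat) (A : 'M[R[i]]_n.+1) k :
  mxn (A ^+ k) <= mxn (1 : 'M[R[i]]_n.+1) * mxn A ^+ k.
Proof.
elim: k => [|k IHk]; first by rewrite !expr0 mulr1.
rewrite exprSr [in leRHS]exprSr mulrA (le_trans (mxnM _ _))//.
by rewrite ler_wpM2r ?mxn_ge0.
Qed.

End MatrixNorm.
(** * The matrix exponential *)

Section ExponentialSeries.

(** The partial sums are taken in an arbitrary algebra, so that one identity,
    [exp_seriesM], serves both complex matrices and the real majorants. *)
Definition exp_series (F : fieldType) (V : algType F) (x : V) (n : nat) : V :=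
  \sum_(k < n) k`!%:R^-1 *: x ^+ k.

(** By the binomial formula [exp_series (x + y) N] collects the terms
    [x ^+ i * y ^+ j / (i! j!)] with [i + j < N]; the product collects all
    those with [i, j < N].  What is left has nonnegative coefficients, and can
    therefore be estimated by the same expression in the norms of [x] and
    [y]. *)
Lemma exp_seriesM (F : numFieldType) (V : algType F) (x y : V) (N : nat) :
  GRing.comm x y ->
  exp_series x N * exp_series y N - exp_series (x + y) N =
  \sum_(i < N) \sum_(j < N | (N <= i + j)%N)
    (i`!%:R^-1 * j`!%:R^-1) *: (x ^+ i * y ^+ j).
Proof.
move=> xy; pose c i j : V := (i`!%:R^-1 * j`!%:R^-1) *: (x ^+ i * y ^+ j).
have -> : exp_series x N * exp_series y N = \sum_(i < N) \sum_(j < N) c i j.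
  rewrite /exp_series mulr_suml; apply: eq_bigr => i _.
  rewrite mulr_sumr; apply: eq_bigr => j _.
  by rewrite -scalerAl -scalerAr scalerA.
have -> : exp_series (x + y) N =
    \sum_(i < N) \sum_(j < N | (i + j < N)%N) c i j.
  have -> : exp_series (x + y) N =
      \sum_(k < N) \sum_(i < N | (i <= k)%N) c i (k - i)%N.
    apply: eq_bigr => k _; rewrite exprDn_comm// scaler_sumr.
    rewrite -(big_ord_widen N (fun i => c i (k - i)%N) (ltn_ord k)).
    rewrite (reindex_inj rev_ord_inj) /=; apply: eq_bigr => i _.
    have ik : (i <= k)%N by rewrite -ltnS.
    rewrite subSS subKn// -[_ *+ 'C(_, _)]scaler_nat scalerA /c; congr (_ *: _).
    rewrite bin_sub// -(bin_fact ik) !natrM !invfM mulrAC mulVf ?mul1r//.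
    by rewrite pnatr_eq0 -lt0n bin_gt0.
  rewrite (exchange_big_dep xpredT) //=; apply: eq_bigr => i _.
  rewrite -(big_mkord (fun k => i <= k)%N (fun k => c i (k - i)%N)).
  rewrite -(big_mkord (fun j => i + j < N)%N (c i)).
  rewrite (big_cat_nat (n := i)) //=; last exact: ltnW.
  rewrite big_nat_cond big1 ?add0r; last first.
    by move=> k /andP[/andP[_ ki]]; rewrite leqNgt ki.
  rewrite [RHS](big_cat_nat (n := (N - i)%N)) ?leq_subr//=.
  rewrite [X in _ = _ + X]big_nat_cond [X in _ = _ + X]big1 ?addr0; last first.
    by move=> k /andP[/andP[ki _]]; rewrite ltnNge -leq_subLR ki.
  rewrite -{1}[i : nat]add0n big_addn big_nat_cond [RHS]big_nat_cond.
  apply: eq_big => k; last by rewrite addnK.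
  by case: (ltnP k) => //= kNi; rewrite leq_addl -ltn_subRL kNi.
rewrite -sumrB; apply: eq_bigr => i _.
rewrite [X in X - _](bigID (fun j : 'I_N => i + j < N)%N) /= addrAC subrr add0r.
by apply: eq_bigl => j; rewrite -leqNgt.
Qed.

Variable R : realType.
Local Notation cabs := (@ComplexField.Normc.normc R).

Lemma exp_seriesE (x : R) n : exp_series (x : R^o) n = series (exp_coeff x) n.
Proof.
rewrite seriesEnat /= big_mkord; apply: eq_bigr => k _.
by rewrite /exp_coeff /= /GRing.scale /= mulrC.
Qed.

Lemma cvg_exp_series (x : R) : exp_series (x : R^o) @ \oo --> expR x.
Proof.
have -> : exp_series (x : R^o) = series (exp_coeff x).
  by apply/funext => n; rewrite exp_seriesE.
exact: is_cvg_series_exp_coeff.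
Qed.

Lemma exp_series_le_expR (x : R) n : 0 <= x -> exp_series (x : R^o) n <= expR x.
Proof.
move=> x0; rewrite -(cvg_lim (@Rhausdorff R) (@cvg_exp_series x)).
apply: nondecreasing_cvgn_le.
  apply/nondecreasing_seqP => k; rewrite /exp_series big_ord_recr /= lerDl.
  by rewrite mulr_ge0// ?invr_ge0// exprn_ge0.
by apply/cvg_ex; eexists; exact: cvg_exp_series.
Qed.

(** Since [(m + k)! >= k!], the tail of the series is at most [x ^+ m] times
    the series itself. *)
Lemma expR_remainder (x : R) m : 0 <= x ->
  expR x - exp_series (x : R^o) m <= x ^+ m * expR x.
Proof.
move=> x0; rewrite lerBlDr.
apply: (ler_cvg_to (@cvg_exp_series x) (@cvg_cst _ _ _ _ _)).
exists m => // n /= mn; rewrite -(subnKC mn) {1}/exp_series.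
rewrite big_split_ord /= addrC lerD2r.
apply: (@le_trans _ _ (x ^+ m * exp_series (x : R^o) (n - m))); last first.
  by rewrite ler_wpM2l ?exprn_ge0// exp_series_le_expR.
rewrite /exp_series mulr_sumr; apply: ler_sum => k _.
rewrite /GRing.scale /= exprD mulrCA ler_wpM2l ?exprn_ge0//.
rewrite ler_wpM2r ?exprn_ge0// lef_pV2 ?posrE ?ltr0n ?fact_gt0// ler_nat.
by rewrite leq_fact// leq_addl.
Qed.

Section MatrixExponential.
Variable n : nat.
Implicit Types A B : 'M[R[i]]_n.+1.
Local Notation one_norm := (mxn (1 : 'M[R[i]]_n.+1)).

Lemma mxn_exp_term A k (a : R) : mxn A <= a ->
  mxn (k`!%:R^-1 *: A ^+ k) <= one_norm * (k`!%:R^-1 * a ^+ k).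
Proof.
move=> Aa; rewrite mxnZ cabsV cabs_nat mulrCA ler_wpM2l//.
rewrite (le_trans (mxnX _ _))// ler_wpM2l ?mxn_ge0//.
by rewrite lerXn2r// ?nnegrE ?mxn_ge0// (le_trans (mxn_ge0 _) Aa).
Qed.

Lemma mxn_exp_seriesB A (a : R) m k : mxn A <= a -> (m <= k)%N ->
  mxn (exp_series A k - exp_series A m) <=
  one_norm * (exp_series (a : R^o) k - exp_series (a : R^o) m).
Proof.
move=> Aa mk; rewrite -(subnKC mk) /exp_series !big_split_ord /=.
rewrite ![_ + _ - _]addrAC !subrr !add0r (le_trans (mxn_sum _ _ _))//.
by rewrite mulr_sumr; apply: ler_sum => i _; exact: mxn_exp_term.
Qed.

(** Here [f] stands for the real or the imaginary part: each of them, in every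
    entry, is a real series which converges absolutely by comparison with the
    series of [expR (mxn A)]. *)
Lemma exp_series_entry_cvg (f : R[i] -> R) A i j :
  (forall z, `|f z| <= cabs z) -> {morph f : x y / x + y} ->
  cvgn (fun k => f (exp_series A k i j)).
Proof.
move=> f_le fD.
have f0 : f 0 = 0.
  by apply/eqP; rewrite -normr_le0 (le_trans (f_le _))// cabs0.
have -> : (fun k => f (exp_series A k i j)) =
    series (fun k => f ((k`!%:R^-1 *: A ^+ k) i j)).
  apply/funext => k; rewrite seriesEnat /= big_mkord /exp_series summxE.
  by elim/big_ind2 : _ => // x1 x2 y1 y2 <- <-.
apply: normed_cvg; apply: (@series_le_cvg _ _
   (fun k => one_norm * exp_coeff (mxn A) k)) => [k|k|k|] //=.
- by rewrite mulr_ge0 ?mxn_ge0// exp_coeff_ge0 ?mxn_ge0.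
- rewrite (le_trans (f_le _))// (le_trans (cabs_le_mxn _ _ _))//.
  rewrite (le_trans (mxn_exp_term _ (lexx _)))// ler_wpM2l ?mxn_ge0//.
  by rewrite /exp_coeff /= mulrC.
apply: is_cvg_seriesZ; exact: is_cvg_series_exp_coeff.
Qed.

(** [expmx] is defined by a [lim] operator; this says that the limit is
    genuine, in the norm [mxn]. *)
Lemma cvg_expmx A : mxn (exp_series A k - expmx A) @[k --> \oo] --> (0 : R).
Proof.
pose re i j := limn (fun k => complex.Re (exp_series A k i j)).
pose im i j := limn (fun k => complex.Im (exp_series A k i j)).
have reP i j : complex.Re (exp_series A k i j) @[k --> \oo] --> re i j.
  apply: exp_series_entry_cvg; first exact: normr_Re_le.
  by case=> [a b] [c d].
have imP i j : complex.Im (exp_series A k i j) @[k --> \oo] --> im i j.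
  apply: exp_series_entry_cvg; first exact: normr_Im_le.
  by case=> [a b] [c d].
pose L : 'M[R[i]]_n.+1 := \matrix_(i, j) Complex (re i j) (im i j).
have SL : mxn (exp_series A k - L) @[k --> \oo] --> (0 : R).
  apply: (@squeeze_cvgr _ _ _ _ (fun=> 0) (fun k => \sum_i \sum_j
     (`|complex.Re (exp_series A k i j) - re i j| +
      `|complex.Im (exp_series A k i j) - im i j|))).
  - apply: nearW => k; rewrite mxn_ge0 /=; apply: ler_sum => i _.
    apply: ler_sum => j _; rewrite (le_trans (cabs_le_ReIm _))// !mxE.
    by case: (exp_series A k i j).
  - exact: cvg_cst.
  - rewrite -[X in _ --> X](_ : \sum_(i < n.+1) \sum_(j < n.+1) (0 + 0 : R) = 0).
      apply: (@cvg_big _ _ +%R 0 xpredT (@add_continuous _)) => i _.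
      apply: (@cvg_big _ _ +%R 0 xpredT (@add_continuous _)) => j _.
      by apply: cvgD; apply/norm_cvg0P/subr_cvg0.
    by rewrite big1// => i _; rewrite big1// => j _; rewrite addr0.
suff -> : expmx A = L by [].
apply: (cvg_lim (@norm_hausdorff _ _)); apply: cvg_mxn.
rewrite (_ : (fun k => _) = (fun k => mxn (exp_series A k - L)))//.
apply/funext => k; congr (mxn (_ - _)).
by rewrite seriesEnat /= big_mkord.
Qed.

End MatrixExponential.
End ExponentialSeries.
Section ExponentialProperties.
Variables (R : realType) (n : nat).
Local Notation cabs := (@ComplexField.Normc.normc R).
Implicit Types A B : 'M[R[i]]_n.+1.
Local Notation one_norm := (mxn (1 : 'M[R[i]]_n.+1)).

(** Used to pass to the limit in norm estimates: a constant bounded by a null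
    sequence is nonpositive. *)
Lemma le0_cvg0 (c : R) (v : nat -> R) :
  v @ \oo --> 0 -> (\forall k \near \oo, c <= v k) -> c <= 0.
Proof. by move=> v0; apply: (ler_cvg_to (@cvg_cst _ _ _ _ _) v0). Qed.

(** The tail of the matrix series is dominated, term by term, by that of the
    real series, for which [expR_remainder] applies. *)
Lemma mxn_exp_remainder A m :
  mxn (expmx A - exp_series A m) <= one_norm * (mxn A ^+ m * expR (mxn A)).
Proof.
rewrite -subr_le0; apply: le0_cvg0 (cvg_expmx A) _.
exists m => // k /= mk; rewrite lerBlDr.
rewrite -[expmx A - _](subrKA (exp_series A k)) (le_trans (mxnD _ _))//.
rewrite mxnBC lerD2l (le_trans (mxn_exp_seriesB (lexx _) mk))//.
rewrite ler_wpM2l ?mxn_ge0// (le_trans _ (expR_remainder _ (mxn_ge0 _)))//.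
by rewrite lerD2r exp_series_le_expR ?mxn_ge0.
Qed.

Lemma mxn_exp_series_le A k : mxn (exp_series A k) <= one_norm * expR (mxn A).
Proof.
have := mxn_exp_seriesB (lexx (mxn A)) (leq0n k).
rewrite /exp_series !big_ord0 !subr0 => /le_trans; apply.
by rewrite ler_wpM2l ?mxn_ge0// exp_series_le_expR ?mxn_ge0.
Qed.

Lemma comm_exp_series A B k : GRing.comm A B -> GRing.comm A (exp_series B k).
Proof.
move=> AB; rewrite /GRing.comm mulr_sumr mulr_suml; apply: eq_bigr => j _.
by rewrite -scalerAr -scalerAl (commrX j AB).
Qed.

Lemma comm_expmx A B : GRing.comm A B -> GRing.comm A (expmx B).
Proof.
move=> AB; apply/eqP; rewrite -subr_eq0; apply/eqP/mxn_eq0/eqP.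
rewrite eq_le mxn_ge0 andbT.
have /(_ eventually_filter) := cvgMl_tmp (a := mxn A + mxn A) (@cvg_expmx _ _ B).
rewrite mulr0 => H. apply: (le0_cvg0 H); apply: nearW => k /=.
rewrite -(subrKA (A * exp_series B k)) -mulrBr (comm_exp_series k AB) -mulrBl.
rewrite (le_trans (mxnD _ _))// [leRHS]mulrDl lerD//.
  by rewrite (le_trans (mxnM _ _))// mxnBC.
by rewrite (le_trans (mxnM _ _))// mulrC.
Qed.

(** By [exp_seriesM] the defect of multiplicativity of the partial sums is at
    most that of the real exponential series at [mxn A] and [mxn B], which
    tends to [0] by [expRD]. *)
Lemma expmxD A B : GRing.comm A B -> expmx (A + B) = expmx A * expmx B.
Proof.
move=> AB; apply/esym/eqP; rewrite -subr_eq0; apply/eqP/mxn_eq0/eqP.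
rewrite eq_le mxn_ge0 andbT; set a := mxn A; set b := mxn B.
have /(_ eventually_filter) H1 := cvgMl_tmp (a := mxn (expmx A)) (@cvg_expmx _ _ B).
have /(_ eventually_filter) H2 :=
  cvgMl_tmp (a := one_norm * expR b) (@cvg_expmx _ _ A).
have H3 : one_norm * one_norm * (exp_series (a : R^o) k * exp_series (b : R^o) k -
    exp_series (a + b : R^o) k) @[k --> \oo] --> (0 : R).
  rewrite -[X in _ --> X](mulr0 (one_norm * one_norm)); apply: cvgMl_tmp.
  rewrite -(subrr (expR (a + b))) {1}expRD; apply: cvgB.
    by apply: cvgM; exact: cvg_exp_series.
  exact: cvg_exp_series.
have /(_ eventually_filter eventually_filter eventually_filter) :=
  cvgD (cvgD H1 H2) (cvgD H3 (@cvg_expmx _ _ (A + B))).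
rewrite !mulr0 !addr0.
move=> H; apply: (le0_cvg0 H); apply: nearW => k /=.
set SA := exp_series A k; set SB := exp_series B k.
have -> : expmx A * expmx B - expmx (A + B) =
   expmx A * (expmx B - SB) + (expmx A - SA) * SB +
   ((SA * SB - exp_series (A + B) k) + (exp_series (A + B) k - expmx (A + B))).
  by rewrite mulrBr mulrBl !subrKA.
rewrite (le_trans (mxnD _ _))// lerD//; rewrite (le_trans (mxnD _ _))// lerD//.
- by rewrite (le_trans (mxnM _ _))// mxnBC.
- rewrite (le_trans (mxnM _ _))// mxnBC mulrC ler_wpM2r ?mxn_ge0//.
  exact: mxn_exp_series_le.
rewrite exp_seriesM// [X in _ * _ * X](@exp_seriesM _ R^o a b); last exact: mulrC.
rewrite mulr_sumr (le_trans (mxn_sum _ _ _))//; apply: ler_sum => i _.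
rewrite mulr_sumr (le_trans (mxn_sum _ _ _))//; apply: ler_sum => j _.
rewrite mxnZ cabsM !cabsV !cabs_nat /GRing.scale /= mulrCA ler_wpM2l//.
by rewrite (le_trans (mxnM _ _))// mulrACA ler_pM ?mxn_ge0// mxnX.
Qed.

Lemma expmx0 : expmx (0 : 'M[R[i]]_n.+1) = 1.
Proof.
apply/eqP; rewrite -subr_eq0; apply/eqP/mxn_eq0/eqP.
rewrite eq_le mxn_ge0 andbT.
have := mxn_exp_remainder 0 1.
by rewrite /exp_series big_ord1 fact0 invr1 scale1r expr0 mxn0 expr1 mul0r mulr0.
Qed.

Lemma expmxNM A : expmx (- A) * expmx A = 1.
Proof. by rewrite -expmxD ?addNr ?expmx0//; exact/commr_sym/commrN. Qed.

Lemma comm_scale (a b : R[i]) A : GRing.comm (a *: A) (b *: A).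
Proof. by rewrite /GRing.comm -!scalerAl -!scalerAr !scalerA mulrC. Qed.

End ExponentialProperties.
(** * Expansion of the grid error *)

Section DefectExpansion.
Variables (R : realType) (n : nat).
Local Notation cabs := (@ComplexField.Normc.normc R).
Implicit Types A B : 'M[R[i]]_n.+1.
Local Notation one_norm := (mxn (1 : 'M[R[i]]_n.+1)).

Lemma mxn_scale_le (z : R[i]) A : cabs z <= 1 -> mxn (z *: A) <= mxn A.
Proof. by move=> z1; rewrite mxnZ ler_piMl ?mxn_ge0. Qed.

Lemma defect_split (E Em S S' : 'M[R[i]]_n.+1) : Em * E = 1 ->
  1 - Em * S - (S' - S) = Em * (E - S') + (Em - 1) * (S' - S).
Proof.
move=> EE; rewrite mulrBl mul1r !mulrBr EE [in RHS]addrA; congr (_ - _).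
by rewrite subrKA.
Qed.

(** Write [T = tau A], [S_m] for the Taylor polynomial with [m] terms and
    [U = S_(p+2)(T) - S_(p+1)(T)] for the first term which the method misses.
    Then [1 - exp(-T) S_(p+1)(T) = exp(-T) (exp T - S_(p+2)(T)) + exp(-T) U];
    here the first summand is a remainder of order [p + 2], and replacing
    [exp(-T)] by [1] in the second one costs another factor [tau]. *)
Lemma step_defect A p : exists2 K : R, 0 <= K &
  forall tau : R[i], cabs tau <= 1 ->
    mxn (1 - expmx (- (tau *: A)) * exp_series (tau *: A) p.+1 -
         tau ^+ p.+1 *: (p.+1`!%:R^-1 *: A ^+ p.+1)) <= K * cabs tau ^+ p.+2.
Proof.
set c := one_norm; set a := mxn A; pose e := expR a.
pose kap := mxn (p.+1`!%:R^-1 *: A ^+ p.+1 : 'M[R[i]]_n.+1).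
have c0 : 0 <= c := mxn_ge0 _; have a0 : 0 <= a := mxn_ge0 _.
have e0 : 0 <= e by exact: expR_ge0.
have kap0 : 0 <= kap := mxn_ge0 _.
exists (c * e * (c * (a ^+ p.+2 * e)) + c * (a * e) * kap).
  by do ?[exact: exprn_ge0|assumption|apply: addr_ge0|apply: mulr_ge0].
move=> tau tau1; set T := tau *: A.
have Te m : mxn T ^+ m * expR (mxn T) <= cabs tau ^+ m * (a ^+ m * e).
  rewrite mxnZ exprMn -mulrA ler_wpM2l ?exprn_ge0 ?cabs_ge0//.
  by rewrite ler_wpM2l ?exprn_ge0// ler_expR -mxnZ mxn_scale_le.
have TN : mxn (- T) = mxn T by exact: mxnN.
set U := tau ^+ p.+1 *: _.
have UE : U = exp_series T p.+2 - exp_series T p.+1.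
  rewrite {1}/exp_series big_ord_recr /= addrAC subrr add0r.
  by rewrite /U exprZn !scalerA mulrC.
have -> : 1 - expmx (- T) * exp_series T p.+1 - U =
    expmx (- T) * (expmx T - exp_series T p.+2) + (expmx (- T) - 1) * U.
  by rewrite UE; exact/defect_split/expmxNM.
rewrite [leRHS]mulrDl (le_trans (mxnD _ _))// lerD// (le_trans (mxnM _ _))//.
  have E1 : mxn (expmx (- T)) <= c * e.
    have := mxn_exp_remainder (- T) 0.
    rewrite /exp_series big_ord0 subr0 expr0 TN => /le_trans; apply.
    by rewrite ler_wpM2l//; have := Te 0%N; rewrite !expr0 !mul1r.
  rewrite -mulrA; apply: ler_pM; rewrite ?mxn_ge0//.
  rewrite (le_trans (mxn_exp_remainder _ _))// -mulrA ler_wpM2l//.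
  by rewrite [leRHS]mulrC; exact: Te.
have := mxn_exp_remainder (- T) 1.
rewrite {1}/exp_series big_ord1 fact0 invr1 scale1r expr0 TN => E1.
have -> : c * (a * e) * kap * cabs tau ^+ p.+2 =
   c * (cabs tau ^+ 1 * (a ^+ 1 * e)) * (cabs tau ^+ p.+1 * kap).
  by rewrite !expr1 exprS; ring.
apply: ler_pM; rewrite ?mxn_ge0//.
  by rewrite (le_trans E1)// ler_wpM2l// Te.
by rewrite /U mxnZ cabsX.
Qed.

Fixpoint defect_prod (u : nat -> 'M[R[i]]_n.+1) (j : nat) : 'M[R[i]]_n.+1 :=
  if j is j'.+1 then (1 - u j') * defect_prod u j' else 1.

Lemma expR_step (v : R) j : 0 <= v -> (1 + v) * expR (j%:R * v) <= expR (j.+1%:R * v).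
Proof.
move=> v0; rewrite -natr1 [(_ + 1) * v]mulrDl mul1r expRD mulrC.
by rewrite ler_wpM2l ?expR_ge0// expR_ge1Dx.
Qed.

Lemma mxn_defect_prodB1 (u : nat -> 'M[R[i]]_n.+1) (v : R) j : 0 <= v ->
  (forall i, (i < j)%N -> mxn (u i) <= v) ->
  mxn (defect_prod u j - 1) <= j%:R * v * expR (j%:R * v).
Proof.
move=> v0; elim: j => [|j IHj] uv /=; first by rewrite subrr mxn0 !mul0r.
have uj : mxn (u j) <= v by exact: uv.
have {}IHj := IHj (fun i ij => uv i (leqW ij)).
have -> : (1 - u j) * defect_prod u j - 1 =
    (defect_prod u j - 1) - u j * (defect_prod u j - 1) - u j.
  by rewrite mulrBl mul1r mulrBr mulr1 opprB addrA [RHS]addrAC addrK addrAC.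
rewrite (le_trans (mxnB _ _))//.
set D := defect_prod u j - 1 in IHj *; set x := expR (j%:R * v) in IHj.
have := expR_step j v0; rewrite -/x; set y := expR (j.+1%:R * v) => xy.
have y1 : 1 <= y by rewrite -expR0 ler_expR mulr_ge0.
apply: (@le_trans _ _ (mxn D * (1 + v) + v)).
  rewrite lerD// [leRHS]mulrDr mulr1 (le_trans (mxnB _ _))// lerD2l mulrC.
  by rewrite (le_trans (mxnM _ _))// ler_wpM2r ?mxn_ge0.
apply: (@le_trans _ _ (j%:R * v * ((1 + v) * x) + v * y)).
  rewrite lerD//; last by rewrite ler_peMr.
  by rewrite [(1 + v) * x]mulrC mulrA ler_wpM2r// addr_ge0.
rewrite -natr1 [(j%:R + 1) * v]mulrDl mul1r mulrDl lerD2r ler_wpM2l//.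
by rewrite mulr_ge0.
Qed.

(** Up to terms of second order in [j v], the product is
    [1 - \sum_i u i].  The increment of the left-hand side is
    [- u j * (defect_prod u j - 1)], whose size is given by
    [mxn_defect_prodB1]. *)
Lemma mxn_defect_prod (u : nat -> 'M[R[i]]_n.+1) (v : R) j : 0 <= v ->
  (forall i, (i < j)%N -> mxn (u i) <= v) ->
  mxn (defect_prod u j - 1 + \sum_(i < j) u i) <=
  (j%:R * v) ^+ 2 * expR (j%:R * v).
Proof.
move=> v0; elim: j => [|j IHj] uv /=.
  by rewrite big_ord0 subrr addr0 mxn0 mul0r expr0n mul0r.
have uj : mxn (u j) <= v by exact: uv.
have uv' i ij := uv i (@leqW i.+1 j ij).
have {}IHj := IHj uv'; have Dj := mxn_defect_prodB1 v0 uv'.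
rewrite big_ord_recr /=.
have -> : (1 - u j) * defect_prod u j - 1 + (\sum_(i < j) u i + u j) =
    (defect_prod u j - 1 + \sum_(i < j) u i) - u j * (defect_prod u j - 1).
  rewrite mulrBl mul1r mulrBr mulr1 opprB !addrA [_ - _ - 1]addrAC.
  by rewrite [_ - _ + \sum_(_ < _) _]addrAC [LHS]addrAC.
rewrite (le_trans (mxnB _ _))//.
set D := defect_prod u j - 1 in IHj Dj *; set x := expR (j%:R * v) in IHj Dj *.
have := expR_step j v0; rewrite -/x; set y := expR (j.+1%:R * v) => xy.
have x0 : 0 <= x := expR_ge0 _.
have {}xy : x <= y by rewrite (le_trans _ xy)// ler_peMl// lerDl.
apply: (@le_trans _ _ ((j%:R * v) ^+ 2 * x + v * (j%:R * v * x))).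
  rewrite lerD//; apply: le_trans (mxnM _ _) _.
  by rewrite ler_pM ?mxn_ge0.
apply: (@le_trans _ _ (((j%:R * v) ^+ 2 + v * (j%:R * v)) * y)).
  by rewrite [X in _ + X]mulrA -mulrDl ler_wpM2l// addr_ge0// !mulr_ge0.
rewrite ler_wpM2r ?expR_ge0// -natr1 -subr_ge0.
have -> : ((j%:R + 1) * v) ^+ 2 - ((j%:R * v) ^+ 2 + v * (j%:R * v)) =
  j%:R * v ^+ 2 + v ^+ 2 by ring.
by rewrite addr_ge0// ?mulr_ge0// ?exprn_ge0.
Qed.

Variables (A : 'M[R[i]]_n.+1) (p : nat).

Lemma mulmx_step (P E Eb Em D : 'M[R[i]]_n.+1) (x : 'cV[R[i]]_n.+1) :
  P * E = E * P -> Eb * Em = 1 ->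
  P *m (E *m (D *m x)) = (E * Eb) *m ((Em * P * D) *m x).
Proof.
move=> PE EE; rewrite !mulmxA -[P *m E]/(P * E) PE; congr (_ *m _).
rewrite -[RHS]/(E * Eb * Em * P * D) -[LHS]/(E * P * D).
by rewrite -[E * Eb * Em]mulrA EE mulr1.
Qed.

(** Variation of constants: after factoring out the exact flow, each step
    multiplies by [exp(- tau A) P(tau A) = 1 - u], which is close to the
    identity.  All factors are functions of [A] and commute. *)
Lemma grid_fun_expmx (M : explicit_rk R[i] p) (g : nat -> R[i])
    (x0 : 'cV[R[i]]_n.+1) j :
  rk_order M p ->
  grid_fun M (fun (_ : R[i]) (x : 'cV[R[i]]_n.+1) => A *m x) g x0 j =
  expmx ((g j - g 0) *: A) *m (defect_prod (fun i =>
     1 - expmx (- ((g i.+1 - g i) *: A)) *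
         exp_series ((g i.+1 - g i) *: A) p.+1) j *m x0).
Proof.
move=> hM; elim: j => [|j IHj] /=.
  by rewrite subrr scale0r expmx0 !mul1mx.
rewrite rk_step_linear order_stability_poly// IHj.
set tau := g j.+1 - g j.
have -> : horner_mx (tau *: A) (\poly_(k < p.+1) k`!%:R^-1) =
    exp_series (tau *: A) p.+1.
  rewrite poly_def rmorph_sum; apply: eq_bigr => k _.
  by rewrite /= horner_mxZ rmorphXn /= horner_mx_X.
have aE : (g j.+1 - g 0) *: A = (g j - g 0) *: A + tau *: A.
  by rewrite -scalerDl [X in _ = X *: A]addrC /tau subrKA.
have PE : GRing.comm (exp_series (tau *: A) p.+1) (expmx ((g j - g 0) *: A)).
  by apply/comm_expmx/commr_sym/comm_exp_series/comm_scale.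
have EE : expmx (tau *: A) * expmx (- (tau *: A)) = 1.
  by rewrite -[X in expmx X * _]opprK expmxNM.
rewrite subKr aE expmxD; last exact: comm_scale.
move: PE EE; set P := exp_series _ _; set E := expmx (_ *: A).
set Eb := expmx (tau *: A); set Em := expmx (- _); set D := defect_prod _ j.
move=> PE EE; exact: mulmx_step.
Qed.

(** The global error is the exact flow applied to the sum of the leading parts
    of the local defects, up to one more power of the step size.  The [N]
    remainders [O(del ^+ p.+2)] add up to [O(del ^+ p.+1)] because [N * del] is
    bounded, and the products of defects are [O(del ^+ (2 * p))]. *)
Lemma grid_error_expansion (x0 : 'cV[R[i]]_n.+1) (T : R[i]) (Lam : R) :
  (0 < p)%N -> 0 <= Lam ->
  exists G : R, forall (M : explicit_rk R[i] p) (g : nat -> R[i]) N (del : R),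
    rk_order M p -> 0 <= del <= 1 -> N%:R * del <= Lam -> g N - g 0 = T ->
    (forall j, (j < N)%N -> cabs (g j.+1 - g j) <= del) ->
    mxn (expmx (T *: A) *m x0 -
         grid_fun M (fun (_ : R[i]) (x : 'cV[R[i]]_n.+1) => A *m x) g x0 N -
         (\sum_(j < N) (g j.+1 - g j) ^+ p.+1) *:
           (p.+1`!%:R^-1 *: (A ^+ p.+1 *m expmx (T *: A) *m x0))) <=
    G * del ^+ p.+1.
Proof.
move=> p0 Lam0; have [K K0 KP] := step_defect A p.
pose B : 'M[R[i]]_n.+1 := p.+1`!%:R^-1 *: A ^+ p.+1.
pose v := K + mxn B; have v0 : 0 <= v by rewrite addr_ge0 ?mxn_ge0.
pose E := expmx (T *: A).
exists (mxn E * (((v * Lam) ^+ 2 * expR (v * Lam)) + K * Lam) * mxn x0).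
move=> M g N del hM /andP[del0 del1] Ndel gT tau_le; rewrite grid_fun_expmx// gT.
set u := (X in defect_prod X).
have tau1 j : (j < N)%N -> cabs (g j.+1 - g j) <= 1.
  by move=> jN; apply: le_trans (tau_le _ jN) del1.
have u_le j : (j < N)%N ->
    mxn (u j - (g j.+1 - g j) ^+ p.+1 *: B) <= K * del ^+ p.+2.
  move=> jN; apply: le_trans (KP _ (tau1 _ jN)) _; rewrite ler_wpM2l//.
  by rewrite lerXn2r ?nnegrE ?cabs_ge0// tau_le.
have uv j : (j < N)%N -> mxn (u j) <= v * del ^+ p.+1.
  move=> jN; rewrite -(subrK ((g j.+1 - g j) ^+ p.+1 *: B) (u j)).
  rewrite (le_trans (mxnD _ _))// mulrDl lerD//.
    rewrite (le_trans (u_le _ jN))// ler_wpM2l// exprS ler_piMl//.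
    exact: exprn_ge0.
  rewrite mxnZ cabsX mulrC ler_wpM2l ?mxn_ge0//.
  by rewrite lerXn2r ?nnegrE ?cabs_ge0// tau_le.
have vd0 : 0 <= v * del ^+ p.+1 by rewrite mulr_ge0// exprn_ge0.
have := mxn_defect_prod vd0 uv.
set F := defect_prod u N - 1 + _ => F_le.
have -> : E *m x0 - E *m (defect_prod u N *m x0) -
   (\sum_(j < N) (g j.+1 - g j) ^+ p.+1) *:
      (p.+1`!%:R^-1 *: (A ^+ p.+1 *m E *m x0)) =
   E *m ((- F + \sum_(j < N) (u j - (g j.+1 - g j) ^+ p.+1 *: B)) *m x0).
  have -> : p.+1`!%:R^-1 *: (A ^+ p.+1 *m E *m x0) = E *m (B *m x0).
    rewrite /B -scalemxAl -scalemxAr mulmxA; congr (_ *: (_ *m _)).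
    apply/commr_sym/commrX/commr_sym; apply: comm_expmx.
    by have := comm_scale 1 T A; rewrite scale1r.
  rewrite scalemxAr -!mulmxBr; congr (_ *m _).
  rewrite -[X in X - _ - _]mul1mx -mulmxBl scalemxAl -mulmxBl; congr (_ *m _).
  rewrite sumrB -scaler_suml /F opprD opprB -[RHS]addrA; congr (_ + _).
  by rewrite addKr.
rewrite (le_trans (mxnM _ _))// -[leRHS]mulrA -[leRHS]mulrA ler_wpM2l ?mxn_ge0//.
rewrite (le_trans (mxnM _ _))// [X in _ <= _ * X]mulrC [leRHS]mulrA.
rewrite ler_wpM2r ?mxn_ge0//.
rewrite mulrDl (le_trans (mxnD _ _))// mxnN lerD//.
  rewrite (le_trans F_le)//.
  have NvL : N%:R * (v * del ^+ p.+1) <= v * Lam * del ^+ p.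
    rewrite exprS mulrCA -!mulrA ler_wpM2l// mulrA ler_wpM2r// exprn_ge0//.
  have NvL0 : 0 <= N%:R * (v * del ^+ p.+1) by rewrite mulr_ge0.
  have vL0 : 0 <= v * Lam by rewrite mulr_ge0.
  apply: (@le_trans _ _ ((v * Lam * del ^+ p) ^+ 2 * expR (v * Lam))).
    apply: ler_pM; rewrite ?exprn_ge0 ?expR_ge0//.
      by rewrite lerXn2r ?nnegrE// (le_trans NvL0 NvL).
    by rewrite ler_expR (le_trans NvL)// ler_piMr// exprn_ile1.
  rewrite exprMn mulrAC ler_wpM2l ?mulr_ge0 ?expR_ge0 ?exprn_ge0//.
  by rewrite -exprM ler_wiXn2l// muln2 -addnn -addn1 leq_add2l.
apply: (@le_trans _ _ (\sum_(j < N) K * del ^+ p.+2)).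
  by rewrite (le_trans (mxn_sum _ _ _))//; apply: ler_sum => j _; exact: u_le.
rewrite sumr_const card_ord -mulr_natl exprS mulrCA -mulrA ler_wpM2l//.
by rewrite mulrA ler_wpM2r// exprn_ge0.
Qed.

End DefectExpansion.
(** * The rescaled maximal step size *)

Section MaxStep.
Variables (R : realType) (gamma : R -> R[i]).
Local Notation cabs := (@ComplexField.Normc.normc R).
Local Notation scaled_step n := (n%:R * max_step gamma n).

Lemma max_step_ge0 n : 0 <= max_step gamma n.
Proof. exact: bigmax_ge_id. Qed.

Lemma le_max_step n j : (j < n)%N -> cabs (grid_step gamma n j) <= max_step gamma n.
Proof.
move=> jn.
exact: (le_bigmax _ (fun j : 'I_n => cabs (grid_step gamma n j)) (Ordinal jn)).
Qed.

Lemma curve_grid_dist n k l : (k <= l)%N -> (l <= n)%N ->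
  cabs (curve_grid gamma n l - curve_grid gamma n k) <=
  (l - k)%:R * max_step gamma n.
Proof.
move=> kl ln; rewrite -(telescope_sumr (curve_grid gamma n) kl).
rewrite (le_trans (cabs_sum _ _ _))// mulr_natl -sumr_const_nat.
rewrite big_nat_cond [leRHS]big_nat_cond; apply: ler_sum => j.
by rewrite andbT => /andP[_ jl]; apply/le_max_step/(leq_trans jl).
Qed.

(** This makes points of two different grids comparable: both lie on the grid
    with [n * m] subintervals. *)
Lemma curve_grid_refine n m j : (0 < m)%N ->
  curve_grid gamma n j = curve_grid gamma (n * m) (j * m).
Proof.
move=> m0; rewrite /curve_grid !natrM -mulf_div divff ?mulr1//.
by rewrite pnatr_eq0 -lt0n.
Qed.

(** The end points of an interval of the [m]-grid lie within [1 / n] of two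
    points of the [n]-grid which are at most [n / m + 1] steps apart.  All the
    points involved belong to the grid with [m * n] subintervals, so the bound
    [Lam] on its rescaled steps controls the two small displacements. *)
Lemma scaled_step_compare (Lam : R) m n : (0 < m)%N -> (0 < n)%N ->
  (forall k, (0 < k)%N -> scaled_step k <= Lam) ->
  scaled_step m <= scaled_step n + 3 * Lam * m%:R / n%:R.
Proof.
move=> m0 n0 hLam.
have nR : 0 < n%:R :> R by rewrite ltr0n.
have mR : 0 < m%:R :> R by rewrite ltr0n.
have Lam_n : max_step gamma n <= Lam / n%:R.
  by rewrite ler_pdivlMr// mulrC hLam.
(* [j * n %/ m] is the index of the last point of the n-grid before j / m. *)
have near_grid j : (j <= m)%N ->
    cabs (curve_grid gamma m j - curve_grid gamma n (j * n %/ m)) <= Lam / n%:R.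
  move=> jm; rewrite (curve_grid_refine m j n0) (curve_grid_refine n _ m0).
  rewrite [(m * n)%N]mulnC.
  rewrite (le_trans (curve_grid_dist (leq_trunc_div _ _) _))//.
    by rewrite mulnC leq_mul2l jm orbT.
  rewrite ler_pdivlMr//; apply: le_trans (hLam (n * m)%N _); last first.
    by rewrite muln_gt0 n0.
  rewrite mulrAC ler_wpM2r ?max_step_ge0// -natrM ler_nat mulnC leq_mul2l.
  by rewrite leq_subLR {1}(divn_eq (j * n) m) leq_add2l ltnW ?ltn_mod ?orbT.
rewrite mulrC -ler_pdivlMr//; apply: bigmax_le => [|[j jm] _ /=].
  by rewrite divr_ge0// addr_ge0 ?mulr_ge0 ?max_step_ge0 ?invr_ge0//
    (le_trans _ (hLam _ m0))// mulr_ge0// max_step_ge0.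
rewrite /grid_step; set k := (j * n %/ m)%N; set l := (j.+1 * n %/ m)%N.
have kl : (k <= l)%N by rewrite leq_div2r// leq_mul2r leqnSn orbT.
have ln : (l <= n)%N.
  by rewrite -[leqRHS](mulnK _ m0) leq_div2r// mulnC leq_mul2l jm orbT.
have lk : (l - k)%:R <= n%:R / m%:R + 1 :> R.
  rewrite -lerBlDr ler_pdivlMr// mulrBl mul1r lerBlDr -natrM -natrD ler_nat.
  rewrite mulnBl leq_subLR (leq_trans (leq_trunc_div _ _))// mulSn addnCA leq_add2l.
  by rewrite {1}(divn_eq (j * n) m) leq_add2l ltnW// ltn_mod.
rewrite -[curve_grid gamma m j.+1](subrK (curve_grid gamma n l)) -addrA.
rewrite -[curve_grid gamma n l - _](subrKA (curve_grid gamma n k)).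
rewrite (le_trans (cabsD _ _))//.
apply: (@le_trans _ _ (Lam / n%:R +
  ((n%:R / m%:R + 1) * max_step gamma n + Lam / n%:R))).
  rewrite lerD ?near_grid// (le_trans (cabsD _ _))// lerD//.
    by rewrite (le_trans (curve_grid_dist kl ln))// ler_wpM2r ?max_step_ge0.
  by rewrite -cabsN opprB near_grid// ltnW.
rewrite [(_ + 1) * _]mulrDl mul1r mulrDl.
have -> : 3 * Lam * m%:R / n%:R / m%:R = Lam / n%:R + Lam / n%:R + Lam / n%:R.
  by field; rewrite !gt_eqF.
have -> : n%:R / m%:R * max_step gamma n = scaled_step n / m%:R.
  by rewrite mulrAC.
by lra.
Qed.

(** By [scaled_step_compare] a value close to the supremum is nearly reached by
    all later ones.  That the limit [s] is an upper bound shows that all steps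
    vanish when [s = 0]. *)
Lemma cvg_scaled_step (Lam : R) :
  (forall k, (0 < k)%N -> scaled_step k <= Lam) ->
  exists2 s : R, scaled_step n @[n --> \oo] --> s &
    forall n, scaled_step n <= s.
Proof.
move=> hLam; pose S := range (fun n => scaled_step n).
have Lam0 : 0 <= Lam.
  by apply: le_trans (hLam 1%N _); rewrite // mulr_ge0// max_step_ge0.
have hLam' k : scaled_step k <= Lam by case: k => [|k]; rewrite ?mul0r// hLam.
have supS : has_sup S.
  split; first by exists (scaled_step 0%N); exists 0%N.
  by exists Lam => _ [k _ <-].
have S_ub n : scaled_step n <= sup S by apply: ub_le_sup; [case: supS|exists n].
exists (sup S) => //; apply/cvgrPdist_lt => e e0.
have e2 : 0 < e / 2 by rewrite divr_gt0.
have [_ [m _ <-] sm] := sup_adherent e2 supS.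
case: m sm => [|m] sm.
  near=> n; rewrite ger0_norm ?subr_ge0// ltrBlDr.
  rewrite mul0r in sm.
  have : 0 <= scaled_step n by rewrite mulr_ge0// max_step_ge0.
  by move: sm; lra.
near=> n; rewrite ger0_norm ?subr_ge0// ltrBlDr.
have n0 : (0 < n)%N by near: n; exists 1%N.
have nR : 0 < n%:R :> R by rewrite ltr0n.
have := scaled_step_compare (ltn0Sn m) n0 hLam.
have : 3 * Lam * m.+1%:R / n%:R < e / 2.
  rewrite ltr_pdivrMr// [ltRHS]mulrC -ltr_pdivrMr//.
  by near: n; exact: nbhs_infty_gtr.
by move: sm; lra.
Unshelve. all: by end_near. Qed.

Lemma cvg_max_step0 (Lam : R) :
  (forall k, (0 < k)%N -> scaled_step k <= Lam) ->
  max_step gamma n @[n --> \oo] --> (0 : R).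
Proof.
move=> hLam; apply/cvgrPdist_lt => e e0; near=> n.
have n0 : (0 < n)%N by near: n; exists 1%N.
have nR : 0 < n%:R :> R by rewrite ltr0n.
rewrite sub0r normrN ger0_norm ?max_step_ge0//.
rewrite -(ltr_pM2l nR) (le_lt_trans (hLam _ n0))// -ltr_pdivrMr//.
by near: n; exact: nbhs_infty_gtr.
Unshelve. all: by end_near. Qed.

End MaxStep.
(** * Averages of arrays as integrals of step functions *)

Section StepSums.
Variable R : realType.
Local Notation mu := (@lebesgue_measure R).

Local Notation I01 := (`[0%R, 1%R[%classic : set R).

Definition cell (n j : nat) : set R := `[j%:R / n%:R, j.+1%:R / n%:R[%classic.

Definition step_fun (n : nat) (c : nat -> R) (u : R) : R :=
  \sum_(j < n) c j * \1_(cell n j) u.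

Lemma measurable_cell n j : measurable (cell n j).
Proof. exact: measurable_itv. Qed.

Lemma in_cell n j u : (0 < n)%N -> 0 <= u ->
  (u \in cell n j) = (Num.truncn (n%:R * u) == j).
Proof.
move=> n0 u0; have nR : 0 < n%:R :> R by rewrite ltr0n.
rewrite truncn_eq ?mulr_ge0//.
apply/idP/idP; rewrite inE /cell /= in_itv /= ler_pdivrMr// ltr_pdivlMr//;
  by rewrite [u * _]mulrC.
Qed.

Lemma step_funE n c u : (0 < n)%N -> 0 <= u < 1 ->
  step_fun n c u = c (Num.truncn (n%:R * u)).
Proof.
move=> n0 /andP[u0 u1]; have nR : 0 < n%:R :> R by rewrite ltr0n.
have kn : (Num.truncn (n%:R * u) < n)%N.
  by rewrite truncn_lt_nat ?mulr_ge0// gtr_pMr.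
rewrite /step_fun (bigD1 (Ordinal kn)) //= big1 ?addr0 => [|j jk].
  by rewrite indicE in_cell// eqxx mulr1.
rewrite indicE in_cell// (_ : (_ == _) = false) ?mulr0//.
by apply: contra_neqF jk => /eqP kj; apply: val_inj.
Qed.

Lemma measurable_step_fun n c (D : set R) : measurable_fun D (step_fun n c).
Proof.
apply: measurable_sum => j; apply: measurable_funM => //.
by apply: measurable_indic; exact: measurable_cell.
Qed.

Lemma integral_step_fun n c : (0 < n)%N ->
  (\int[mu]_(u in I01) (step_fun n c u)%:E = (n%:R^-1 * \sum_(j < n) c j)%:E)%E.
Proof.
move=> n0; have nR : 0 < n%:R :> R by rewrite ltr0n.
have mI : measurable I01 by exact: measurable_itv.
have mu_cell (j : 'I_n) : mu (cell n j `&` I01) = (n%:R^-1)%:E.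
  rewrite (_ : _ `&` _ = cell n j).
    rewrite lebesgue_measure_itv /= lte_fin ltr_pM2r ?invr_gt0// ltr_nat ltnSn.
    by rewrite -EFinB -mulrBl -natrB// subSnn mul1r.
  apply/seteqP; split => u /=; first by case.
  move=> uc; split => //; move: uc; rewrite /cell /= !in_itv /= => /andP[ju uj].
  apply/andP; split; first by rewrite (le_trans _ ju)// divr_ge0.
  by rewrite (lt_le_trans uj)// ler_pdivrMr// mul1r ler_nat.
have int_cell (j : 'I_n) :
    mu.-integrable I01 (fun u => (\1_(cell n j) u)%:E).
  by apply: integrableS (integrable_indic_itv _ _ _ _).
have -> : (fun u => (step_fun n c u)%:E) =
    (fun u => \sum_(j < n) ((c j)%:E * (\1_(cell n j) u)%:E))%E.
  by apply/funext => u; rewrite /step_fun -sumEFin.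
rewrite integral_sum => [|//|j]; last exact: integrableZl.
rewrite mulr_sumr -sumEFin; apply: eq_bigr => j _.
rewrite integralZl// integral_indic//; last exact: measurable_cell.
transitivity ((c j)%:E * (n%:R^-1)%:E)%E; last by rewrite -EFinM mulrC.
by congr (_ * _)%E; exact: mu_cell.
Qed.

(** The average is the integral over [[0, 1[] of the step function with values
    [c n j], and these step functions converge almost everywhere and are
    bounded: dominated convergence applies.  The upper limit serves as a
    candidate for the limit function because it is measurable without knowing
    where the sequence converges. *)
Lemma cvg_step_sum (c : nat -> nat -> R) (B : R) :
  (forall n j, (j < n)%N -> `|c n j| <= B) ->
  {ae mu, forall u, u \in `[0, 1[ ->
    cvgn (fun n => c n (Num.truncn (n%:R * u)))} ->
  cvgn (fun n => n%:R^-1 * \sum_(j < n) c n j).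
Proof.
move=> cB cvg_c.
pose f n u := (step_fun n (c n) u)%:E.
pose g u := limn_esup (fun n => f n u).
have mD : measurable I01 by exact: measurable_itv.
have mf n : measurable_fun I01 (f n).
  apply/measurable_EFinP; exact: measurable_step_fun.
have mg : measurable_fun I01 g.
  exact: measurable_fun_limn_esup.
have fg : {ae mu, forall u, I01 u -> f ^~ u @ \oo --> g u}.
  have [N [mN N0 cN]] := cvg_c; exists N; split => // u nfu; apply: cN => cu.
  apply: nfu => /= uD.
  have /cvg_ex[l cl] := cu uD; have fl : f ^~ u @ \oo --> l%:E.
    apply: cvg_EFin; first exact: nearW.
    apply: cvg_trans cl; apply: near_eq_cvg; near=> n => /=.
    have n0 : (0 < n)%N by near: n; exists 1%N.
    by rewrite step_funE//; move: uD; rewrite /= in_itv.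
  have cf : cvgn (f ^~ u) by apply/cvg_ex; exists l%:E.
  by rewrite /g is_cvg_limn_esupE.
have ig : mu.-integrable I01 (EFin \o cst `|B|).
  apply: measurable_bounded_integrable => //.
    by rewrite /= lebesgue_measure_itv /= lte_fin ltr01 -EFinB ltry.
  exact: bounded_cst.
have fB : {ae mu, forall u n, I01 u -> (`|f n u| <= (EFin \o cst `|B|%R) u)%E}.
  apply: (@aeW _ _ _ mu) => u [|n] /= uD.
    by rewrite lee_fin /step_fun big_ord0 normr0.
  move: uD; rewrite in_itv /= => /andP[u0 u1].
  rewrite lee_fin step_funE ?u0//.
  apply: (le_trans (cB _ _ _)); last exact: ler_norm.
  by rewrite truncn_lt_nat ?mulr_ge0// gtr_pMr.
have [ig' _ cvg_int] := @dominated_convergence _ _ _ mu _ mD _ _ _ mf mg fg ig fB.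
apply/cvg_ex; exists (fine (\int[mu]_(u in I01) g u)%E).
have /fineK gE : (\int[mu]_(u in I01) g u)%E \is a fin_num.
  exact: integral_fune_fin_num.
rewrite -gE in cvg_int; move: cvg_int => /fine_cvg.
apply: cvg_trans; apply: near_eq_cvg; near=> n => /=.
by rewrite integral_step_fun//; near: n; exists 1%N.
Unshelve. all: by end_near. Qed.

End StepSums.
(** * Power sums of the steps of a curve *)

Section ComplexLimits.
Variable R : realType.
Local Notation cabs := (@ComplexField.Normc.normc R).
Implicit Types (z : nat -> R[i]) (l : R[i]).

(** Real and imaginary parts are kept apart because the power sums below are
    compared with integrals of real functions. *)
Definition cvg_ReIm z l : Prop :=
  complex.Re (z n) @[n --> \oo] --> complex.Re l /\
  complex.Im (z n) @[n --> \oo] --> complex.Im l.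

Lemma cvg_ReImM z w l m : cvg_ReIm z l -> cvg_ReIm w m ->
  cvg_ReIm (fun n => z n * w n) (l * m).
Proof.
move=> [zr zi] [wr wi]; split.
  have -> : (fun n => complex.Re (z n * w n)) = (fun n =>
    complex.Re (z n) * complex.Re (w n) - complex.Im (z n) * complex.Im (w n)).
    by apply/funext => n; case: (z n) (w n) => [a b] [c d].
  have -> : complex.Re (l * m) =
    complex.Re l * complex.Re m - complex.Im l * complex.Im m.
    by case: l m {zr zi wr wi} => [a b] [c d].
  by apply: cvgB; apply: cvgM.
have -> : (fun n => complex.Im (z n * w n)) = (fun n =>
    complex.Re (z n) * complex.Im (w n) + complex.Im (z n) * complex.Re (w n)).
  by apply/funext => n; case: (z n) (w n) => [a b] [c d].
have -> : complex.Im (l * m) =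
    complex.Re l * complex.Im m + complex.Im l * complex.Re m.
  by case: l m {zr zi wr wi} => [a b] [c d].
by apply: cvgD; apply: cvgM.
Qed.

Lemma cvg_ReImX z l k : cvg_ReIm z l -> cvg_ReIm (fun n => z n ^+ k) (l ^+ k).
Proof.
move=> zl; elim: k => [|k IHk]; first by split; exact: cvg_cst.
rewrite exprS; under [X in cvg_ReIm X _]eq_fun do rewrite exprS.
exact: cvg_ReImM.
Qed.

Lemma cvg_ReIm_cabs z l :
  cvg_ReIm z l -> cabs (z n - l) @[n --> \oo] --> (0 : R).
Proof.
move=> [zr zi]; apply: (@squeeze_cvgr _ _ _ _ (fun=> 0) (fun n =>
    `|complex.Re (z n) - complex.Re l| + `|complex.Im (z n) - complex.Im l|)).
- apply: nearW => n; rewrite cabs_ge0 /= (le_trans (cabs_le_ReIm _))//.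
  by case: (z n) (l) => [a b] [c d].
- exact: cvg_cst.
- by rewrite -[X in _ --> X](addr0 0); apply: cvgD; apply/norm_cvg0P/subr_cvg0.
Qed.

End ComplexLimits.

Section PowerSums.
Variable R : realType.
Local Notation cabs := (@ComplexField.Normc.normc R).

(** The two points of the grid which enclose [u] both depend on [n], but the
    error of the linear approximation of [f] at [u] is [o(1 / n)] at each of
    them. *)
Lemma cvg_difference_quotient (f : R -> R) (u : R) : 0 <= u -> derivable f u 1 ->
  n%:R * (f ((Num.truncn (n%:R * u)).+1%:R / n%:R) -
          f ((Num.truncn (n%:R * u))%:R / n%:R)) @[n --> \oo] --> 'D_1 f u.
Proof.
move=> u0 df; set d := 'D_1 f u.
apply/cvgrPdist_le => e e0; have e2 : 0 < e / 2 by rewrite divr_gt0.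
have : \forall h \near (0 : R), `|f (u + h) - f u - h * d| <= e / 2 * `|h|.
  have : \forall h \near (0 : R)^',
      `|d - h^-1 *: ((f \o shift u) (h *: (1 : R)) - f u)| <= e / 2.
    by move: (e / 2) e2; apply/cvgrPdist_le; exact: df.
  rewrite near_withinE; apply: filterS => h.
  have [->|h0 /(_ isT)] := eqVneq h 0.
    by rewrite addr0 subrr mul0r subrr normr0 mulr0.
  rewrite /= /GRing.scale /= mulr1 addrC => dh.
  have -> : f (u + h) - f u - h * d = - h * (d - h^-1 * (f (h + u) - f u)).
    by rewrite [h + u]addrC; field.
  by rewrite normrM normrN mulrC ler_wpM2r// addrC.
move=> /nbhs_ballP[r /= r0 fr].
near=> n.
have n0 : (0 < n)%N by near: n; exists 1%N.
have nR : 0 < n%:R :> R by rewrite ltr0n.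
have nr : n%:R^-1 < r.
  rewrite invf_plt ?posrE//; near: n; exact: nbhs_infty_gtr.
set k := Num.truncn _.
have /andP[ku uk] : k%:R <= n%:R * u < k.+1%:R by rewrite truncn_itv// mulr_ge0.
have {}ku : k%:R / n%:R <= u by rewrite ler_pdivrMr// mulrC.
have {}uk : u < k.+1%:R / n%:R by rewrite ltr_pdivlMr// mulrC.
have kk : k.+1%:R / n%:R = k%:R / n%:R + n%:R^-1 :> R by rewrite -natr1 mulrDl mul1r.
have close x : `|x - u| <= n%:R^-1 ->
    `|f x - f u - (x - u) * d| <= e / 2 * n%:R^-1.
  move=> xu; have := fr (x - u); rewrite /ball /= sub0r normrN [u + _]addrC subrK.
  move=> /(_ (le_lt_trans xu nr)) /le_trans; apply.
  by rewrite ler_wpM2l// ltW.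
have Ha := close (k%:R / n%:R); have Hb := close (k.+1%:R / n%:R).
set a := k%:R / n%:R in ku kk Ha *; set b := k.+1%:R / n%:R in uk kk Hb *.
have {}Ha : `|f a - f u - (a - u) * d| <= e / 2 * n%:R^-1.
  by apply: Ha; rewrite distrC ger0_norm ?subr_ge0//; move: uk kk; lra.
have {}Hb : `|f b - f u - (b - u) * d| <= e / 2 * n%:R^-1.
  by apply: Hb; rewrite ger0_norm ?subr_ge0 ?(ltW uk)//; move: ku kk; lra.
have -> : d - n%:R * (f b - f a) = n%:R *
    ((f a - f u - (a - u) * d) - (f b - f u - (b - u) * d)).
  by rewrite kk; field; rewrite gt_eqF.
rewrite normrM gtr0_norm// -ler_pdivlMl// (le_trans (ler_normB _ _))//.
by rewrite (le_trans (lerD Ha Hb))// -mulrDl -splitr mulrC.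
Unshelve. all: by end_near. Qed.

Variables (gamma : R -> R[i]) (Lam : R).
Hypothesis gamma_curve : is_curve gamma.
Hypothesis hLam : forall k, (0 < k)%N -> k%:R * max_step gamma k <= Lam.

Lemma Re_nat_mul n (z : R[i]) : complex.Re (n%:R * z) = n%:R * complex.Re z.
Proof. by rewrite !mulr_natl raddfMn. Qed.

Lemma Im_nat_mul n (z : R[i]) : complex.Im (n%:R * z) = n%:R * complex.Im z.
Proof. by rewrite !mulr_natl raddfMn. Qed.

(** For almost every [u] the rescaled step of the cell containing [u] tends to
    the derivative of [gamma] at [u]; the limit [q] is thus the integral of the
    [k]-th power of that derivative. *)
Lemma cvg_power_sum k : exists q : R[i], cvg_ReIm
  (fun n => (n%:R^-1)%:C * \sum_(j < n) (n%:R * grid_step gamma n j) ^+ k) q.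
Proof.
have step_cvg : {ae lebesgue_measure, forall u : R, u \in `[0, 1[ ->
   exists l, cvg_ReIm (fun n =>
     (n%:R * grid_step gamma n (Num.truncn (n%:R * u))) ^+ k) l}.
  have [_ [N [mN N0 dN]] _] := gamma_curve; exists N; split => // u ncu.
  apply: dN => du; apply: ncu => /=; rewrite in_itv /= => /andP[u0 u1].
  have [dr di] : derivable (fun v => complex.Re (gamma v)) u 1 /\
      derivable (fun v => complex.Im (gamma v)) u 1.
    by apply: du; rewrite in_itv /= u0 ltW.
  eexists; apply: (cvg_ReImX (l := Complex ('D_1 (fun v => complex.Re (gamma v)) u)
    ('D_1 (fun v => complex.Im (gamma v)) u))); split.
    under eq_fun do rewrite Re_nat_mul raddfB.
    exact: cvg_difference_quotient.
  under eq_fun do rewrite Im_nat_mul raddfB.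
  exact: cvg_difference_quotient.
have step_le n j : (j < n)%N ->
    cabs ((n%:R * grid_step gamma n j) ^+ k) <= Lam ^+ k.
  move=> jn; have n0 : (0 < n)%N by rewrite (leq_trans _ jn).
  rewrite cabsX cabsM cabs_nat.
  have H : n%:R * cabs (grid_step gamma n j) <= Lam.
    by rewrite (le_trans _ (hLam n0))// ler_wpM2l// le_max_step.
  by rewrite lerXn2r// nnegrE ?(le_trans _ H)// mulr_ge0// cabs_ge0.
have cRe : cvgn (fun n => n%:R^-1 * \sum_(j < n)
    complex.Re ((n%:R * grid_step gamma n j) ^+ k)).
  apply: (@cvg_step_sum _ (fun n j =>
    complex.Re ((n%:R * grid_step gamma n j) ^+ k)) (Lam ^+ k)).
    by move=> n j jn; rewrite (le_trans (normr_Re_le _))// step_le.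
  have [N [mN N0 dN]] := step_cvg; exists N; split => // u ncu; apply: dN => du.
  by apply: ncu => /= /du[l [lr _]]; apply/cvg_ex; eexists; exact: lr.
have cIm : cvgn (fun n => n%:R^-1 * \sum_(j < n)
    complex.Im ((n%:R * grid_step gamma n j) ^+ k)).
  apply: (@cvg_step_sum _ (fun n j =>
    complex.Im ((n%:R * grid_step gamma n j) ^+ k)) (Lam ^+ k)).
    by move=> n j jn; rewrite (le_trans (normr_Im_le _))// step_le.
  have [N [mN N0 dN]] := step_cvg; exists N; split => // u ncu; apply: dN => du.
  by apply: ncu => /= /du[l [_ li]]; apply/cvg_ex; eexists; exact: li.
case/cvg_ex: cRe => a ca; case/cvg_ex: cIm => b cb; exists (Complex a b); split.
  apply: cvg_trans ca; apply: near_eq_cvg; apply: nearW => n /=.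
  by rewrite -raddf_sum; case: (\sum_(j < n) _) => x y /=; rewrite mul0r subr0.
apply: cvg_trans cb; apply: near_eq_cvg; apply: nearW => n /=.
by rewrite -raddf_sum; case: (\sum_(j < n) _) => x y /=; rewrite mul0r addr0.
Qed.

(** The quotient is homogeneous of degree one: with the steps rescaled by [n]
    it is [(n delta_n) ^- p] times the average of [cvg_power_sum].  If
    [n delta_n] tends to [0], all steps vanish and so does the quotient, since
    the inverse of [0 ^+ p] is [0]. *)
Lemma cvg_error_coef p : (0 < p)%N -> exists l : R[i],
  cabs (((max_step gamma n)%:C ^+ p)^-1 *
    \sum_(j < n) grid_step gamma n j ^+ p.+1 - l) @[n --> \oo] --> (0 : R).
Proof.
move=> p0; have [q Hq] := cvg_power_sum p.+1.
have [s cs s_ub] := cvg_scaled_step hLam.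
have s0 : 0 <= s by apply: le_trans (s_ub 0%N); rewrite mul0r.
move: s0; rewrite le_eqVlt => /predU1P[s0|s0].
  exists 0; apply: cvg_near_cst; near=> n.
  have n0 : (0 < n)%N by near: n; exists 1%N.
  have -> : max_step gamma n = 0.
    apply/eqP; rewrite eq_le max_step_ge0 andbT.
    by have := s_ub n; rewrite -s0 pmulr_rle0// ltr0n.
  by rewrite expr0n eqn0Ngt p0 invr0 mul0r subrr cabs0.
exists (((s ^+ p)^-1)%:C * q).
have cr : cvg_ReIm (fun n => (((n%:R * max_step gamma n) ^+ p)^-1)%:C)
    ((s ^+ p)^-1)%:C.
  split; last exact: cvg_cst.
  apply: cvgV; first by rewrite expf_neq0// gt_eqF.
  exact: cvg_comp cs (@exprn_continuous _ p s).
have /cvg_ReIm_cabs := cvg_ReImM cr Hq.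
apply: cvg_trans; apply: near_eq_cvg; near=> n.
have n0 : n%:R != 0 :> R by rewrite pnatr_eq0 -lt0n; near: n; exists 1%N.
have nC0 : n%:R != 0 :> R[i] by rewrite pnatr_eq0 -lt0n; near: n; exists 1%N.
congr (cabs (_ - _)).
under eq_bigr do rewrite exprMn.
rewrite -mulr_sumr; set S := \sum_(j < n) _.
rewrite !fmorphV rmorphXn rmorphM /= !rmorph_nat exprMn invfM exprS.
set D := (_%:C ^+ p)^-1; field.
by rewrite nC0 expf_neq0.
Unshelve. all: by end_near. Qed.

End PowerSums.

Section MainLimit.
Variable R : realType.
Local Notation cabs := (@ComplexField.Normc.normc R).

Lemma cvg0_mxn_scale (m n : nat) (z : nat -> R[i]) (l : R[i])
    (V : 'M[R[i]]_(m, n)) :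
  cabs (z k - l) @[k --> \oo] --> (0 : R) ->
  mxn (z k *: V - l *: V) @[k --> \oo] --> (0 : R).
Proof.
move=> zl; under eq_fun do rewrite -scalerBl mxnZ.
by rewrite -(mul0r (mxn V)); apply: cvgMr_tmp.
Qed.

Lemma cvg0_mxn_trans (m n : nat) (u w : nat -> 'M[R[i]]_(m, n))
    (L : 'M[R[i]]_(m, n)) :
  mxn (u k - w k) @[k --> \oo] --> (0 : R) ->
  mxn (w k - L) @[k --> \oo] --> (0 : R) ->
  mxn (u k - L) @[k --> \oo] --> (0 : R).
Proof.
move=> uw wL; apply: (@squeeze_cvgr _ _ _ _ (fun=> 0) (fun k =>
  mxn (u k - w k) + mxn (w k - L))).
- apply: nearW => k; rewrite mxn_ge0 /= -[u k - L](subrKA (w k)).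
  exact: mxnD.
- exact: cvg_cst.
- by rewrite -[X in _ --> X](addr0 0); apply: cvgD.
Qed.

End MainLimit.

(** * The limit of the rescaled grid error *)

Theorem theorem4p2 (R : realType) (d p : nat) (hd : (0 < d)%N) (hp : (0 < p)%N)
    (A : 'M[R[i]]_d) (t0 t : R[i]) (x0 : 'cV[R[i]]_d)
    (gamma : R -> R[i]) (hgamma : is_curve gamma)
    (hgamma0 : gamma 0 = t0) (hgamma1 : gamma 1 = t)
    (C : R) (hC : 0 < C)
    (hstep : forall n : nat, (0 < n)%N ->
       max_step gamma n <= C * (curve_length gamma / n%:R))
    (M : explicit_rk R[i] p) (hM : rk_order M p) :
  let tau := grid_step gamma in
  let delta := fun n : nat => (max_step gamma n)%:C in
  let eps := end_error A M gamma x0 in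
  let lhs : nat -> 'cV[R[i]]_d := fun n => (delta n ^+ p)^-1 *: eps n in
  let rhs : nat -> 'cV[R[i]]_d := fun n =>
    ((delta n ^+ p)^-1 * \sum_(j < n) tau n j ^+ p.+1) *:
      ((p.+1)`!%:R^-1 *: (A ^+ p.+1 *m expmx ((t - t0) *: A) *m x0)) in
  [/\ cvgn lhs, cvgn rhs & limn lhs = limn rhs].
Proof.
case: d hd A x0 => [//|n] _ {}A {}x0 tau delta eps lhs rhs.
subst t0 t.
pose Lam := C * curve_length gamma.
have hLam k : (0 < k)%N -> k%:R * max_step gamma k <= Lam.
  move=> k0; rewrite mulrC -ler_pdivlMr ?ltr0n// -mulrA; exact: hstep.
have Lam0 : 0 <= Lam.
  by apply: le_trans (hLam 1%N _); rewrite // mulr_ge0// max_step_ge0.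
have [l cvg_l] := cvg_error_coef hgamma hLam hp.
have [G GP] := grid_error_expansion A x0 (gamma 1 - gamma 0) hp Lam0.
pose V : 'cV[R[i]]_n.+1 := p.+1`!%:R^-1 *:
  (A ^+ p.+1 *m expmx ((gamma 1 - gamma 0) *: A) *m x0).
have rhs0 : mxn (rhs n - l *: V) @[n --> \oo] --> (0 : R).
  exact: cvg0_mxn_scale.
have cvg_rhs : rhs @ \oo --> l *: V by exact: cvg_mxn.
have diff0 : mxn (lhs n - rhs n) @[n --> \oo] --> (0 : R).
  apply: (@squeeze_cvgr _ _ _ _ (fun=> 0) (fun n => `|G| * max_step gamma n)).
  - near=> k; rewrite mxn_ge0 /=.
    have k0 : (0 < k)%N by near: k; exists 1%N.
    have D0 : 0 <= max_step gamma k := max_step_ge0 _ _.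
    rewrite /lhs /rhs -scalerA -scalerBr mxnZ cabsV cabsX cabs_real ger0_norm//.
    (* A grid without movement: the inverse of [0 ^+ p] is [0]. *)
    have [->|Dneq0] := eqVneq (max_step gamma k) 0.
      by rewrite expr0n eqn0Ngt hp invr0 mul0r mulr0.
    have Dpos : 0 < max_step gamma k by rewrite lt_neqAle eq_sym Dneq0.
    rewrite mulrC ler_pdivrMr ?exprn_gt0// -mulrA -exprS.
    apply: (@le_trans _ _ (G * max_step gamma k ^+ p.+1)); last first.
      by rewrite ler_wpM2r ?ler_norm// exprn_ge0.
    apply: GP => //.
    + rewrite D0 /= ltW//; near: k.
      exact: (cvgr_lt _ (cvg_max_step0 hLam)).
    + exact: (hLam k k0).
    + by rewrite /curve_grid divff ?mul0r// pnatr_eq0 -lt0n.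
    + by move=> j jk; exact: le_max_step.
  - exact: cvg_cst.
  - rewrite -[X in _ --> X](mulr0 `|G|); apply: cvgMl_tmp.
    exact: (cvg_max_step0 hLam).
clearbody lhs rhs.
have cvg_lhs : lhs @ \oo --> l *: V.
  by apply: cvg_mxn; apply: cvg0_mxn_trans diff0 rhs0.
split.
- by apply/cvg_ex; exists (l *: V).
- by apply/cvg_ex; exists (l *: V).
- by rewrite (cvg_lim (@norm_hausdorff _ _) cvg_lhs)
             (cvg_lim (@norm_hausdorff _ _) cvg_rhs).
Unshelve. all: by end_near. Qed.
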